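(* Assume that the Slater-type Assumption 1 (see context, with $\mathcal K=\mathcal S^n$) holds. Let $(\overline W,\bar y)$ be an accumulation point of the infinite sequence $\{(W^j,y^j)\}$ generated by Algorithm SNCG (described in the context) for solving $$\min\{\varphi(W,y)\mid (W,y)\in{\rm Ran}(\mathcal Q)\times\mathbb R^m\}.$$ Assume that the constraint nondegeneracy condition $$\mathcal A\,{\rm lin}(\mathcal T_{\mathcal S^n_+}(\overline Y))=\mathbb R^m$$ holds at $\overline Y:=\Pi_{\mathcal S^n_+}(\mathcal A^*\bar y-\mathcal Q\overline W-\widehat C)$. Then the whole sequence $\{(W^j,y^j)\}$ converges to $(\overline W,\bar y)$ and $$\|(W^{j+1},y^{j+1})-(\overline W,\bar y)\|=O\big(\|(W^j,y^j)-(\overline W,\bar y)\|^{1+\tau}\big),$$ where $\tau\in(0,1]$ is the parameter of Algorithm SNCG.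
   Context: $\mathcal S^n$ is the space of real symmetric $n\times n$ matrices with trace inner product and Frobenius norm; $\mathcal S^n_+$, $\mathcal S^n_{++}$ are the positive semidefinite and positive definite cones; $\Pi_{\mathcal S^n_+}$ is the metric projection onto $\mathcal S^n_+$. $\mathcal Q:\mathcal S^n\to\mathcal S^n$ is a self-adjoint positive semidefinite linear operator with range ${\rm Ran}(\mathcal Q)$; $\mathcal A:\mathcal S^n\to\mathbb R^m$ is linear with adjoint $\mathcal A^*$; $b\in\mathbb R^m$, $C,\widehat X\in\mathcal S^n$ and $\sigma>0$ are given, and $\widehat C=C-\sigma^{-1}\widehat X$. $\mathcal T_{\mathcal S^n_+}(Y)$ is the tangent cone of $\mathcal S^n_+$ at $Y$ and ${\rm lin}$ denotes the lineality space (largest linear subspace contained in the cone). Assumption 1 for the case $\mathcal K=\mathcal S^n$: there exists $X_0\in\mathcal S^n_{++}$ with $\mathcal AX_0=b$, and $\mathcal A(\mathcal S^n)=\mathbb R^m$. Define $S(W,y)=\mathcal A^*y-\mathcal QW-\widehat C$ and, on ${\rm Ran}(\mathcal Q)\times\mathbb R^m$, $$\varphi(W,y)=\tfrac12\langle W,\mathcal QW\rangle-\langle b,y\rangle+\tfrac\sigma2\|\Pi_{\mathcal S^n_+}(S(W,y))\|^2,$$ which is continuously differentiable with $$\nabla\varphi(W,y)=\begin{pmatrix}\mathcal QW-\sigma\mathcal Q\Pi_{\mathcal S^n_+}(S(W,y))\\ -b+\sigma\mathcal A\Pi_{\mathcal S^n_+}(S(W,y))\end{pmatrix}.$$ For $(W,y)$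 take an eigenvalue decomposition $S(W,y)=P\Gamma P^T$ with $P$ orthogonal and eigenvalues $\lambda_1\ge\dots\ge\lambda_n$; let $\alpha=\{i\mid\lambda_i>0\}$, $\bar\alpha=\{i\mid\lambda_i\le0\}$, and define $U:\mathcal S^n\to\mathcal S^n$ by $U(H)=P(\Sigma\circ(P^THP))P^T$, where $\circ$ is the Hadamard product and the symmetric matrix $\Sigma$ has entries $\Sigma_{ij}=1$ for $i,j\in\alpha$, $\Sigma_{ij}=\Sigma_{ji}=\lambda_i/(\lambda_i-\lambda_j)$ for $i\in\alpha,j\in\bar\alpha$, and $\Sigma_{ij}=0$ for $i,j\in\bar\alpha$. This $U$ belongs to the Clarke subdifferential $\partial\Pi_{\mathcal S^n_+}(S(W,y))$. Algorithm SNCG: given $\mu\in(0,1/2)$, $\bar\eta\in(0,1)$, $\tau\in(0,1]$, $\tau_1,\tau_2\in(0,1)$, $\delta\in(0,1)$ and $(W^0,y^0)\in{\rm Ran}(\mathcal Q)\times\mathbb R^m$, for $j=0,1,\dots$: Step 1: let $U_j$ be the operator $U$ above at $(W^j,y^j)$, and set $$V_j=\begin{bmatrix}\mathcal Q&\\&0\end{bmatrix}+\sigma\begin{bmatrix}\mathcal Q\\-\mathcal A\end{bmatrix}U_j\,[\mathcal Q\ \ -\mathcal A^*],\qquad \epsilon_j=\tau_1\min\{\tau_2,\|\nabla\varphi(W^j,y^j)\|\}.$$ Apply the conjugate gradient (CG) algorithm to find an approximate solution $(d_W^j,d_y^j)\in{\rm Ran}(\mathcal Q)\times\mathbb R^m$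 of $V_j(d_W,d_y)+\epsilon_j(0,d_y)=-\nabla\varphi(W^j,y^j)$ such that $$\|V_j(d_W^j,d_y^j)+\epsilon_j(0,d_y^j)+\nabla\varphi(W^j,y^j)\|\le\eta_j:=\min(\bar\eta,\|\nabla\varphi(W^j,y^j)\|^{1+\tau}).$$ Step 2: set $\alpha_j=\delta^{m_j}$, where $m_j$ is the first nonnegative integer $m$ for which $$\varphi(W^j+\delta^md_W^j,y^j+\delta^md_y^j)\le\varphi(W^j,y^j)+\mu\delta^m\langle\nabla\varphi(W^j,y^j),(d_W^j,d_y^j)\rangle.$$ Step 3: set $W^{j+1}=W^j+\alpha_jd_W^j$, $y^{j+1}=y^j+\alpha_jd_y^j$. *)

(* Defs.v *)
From HB Require Import structures.
From mathcomp Require Import all_boot all_order all_algebra.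
From mathcomp Require Import all_classical all_reals all_analysis.
Set Implicit Arguments.
Unset Strict Implicit.
Unset Printing Implicit Defensive.
Import Order.TTheory GRing.Theory Num.Theory.
Import numFieldNormedType.Exports.
Local Open Scope classical_set_scope.
Local Open Scope ring_scope.

(* R^m is 'cV[R]_m, and S^n is the set symS of
   symmetric matrices in 'M[R]_n: an operator S^n -> S^n is a linear map on
   'M[R]_n that preserves symS, of which only the restriction to symS matters. *)

Section InnerProducts.
Variable R : realType.

(* The trace (Frobenius) inner product on matrices; the Euclidean one on columns. *)
Definition mxdot (p q : nat) (X Y : 'M[R]_(p, q)) : R := \tr (X^T *m Y).

Definition mxfnorm (p q : nat) (X : 'M[R]_(p, q)) : R := Num.sqrt (mxdot X X).

Variables m n : nat.
Local Notation E := ('M[R]_n * 'cV[R]_m)%type.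

Definition pdot (u v : E) : R := mxdot u.1 v.1 + mxdot u.2 v.2.

Definition pnorm (u : E) : R := Num.sqrt (pdot u u).

(* g is the (Frechet) gradient at z of the restriction of f to the linear
   subspace L, for the inner product that L inherits from E. *)
Definition is_gradient (L : set E) (f : E -> R) (z g : E) : Prop :=
  L g /\ forall e : R, 0 < e ->
    \forall h \near (0 : E), L h ->
      `|f (z + h) - f z - pdot g h| <= e * pnorm h.

Definition gradient (L : set E) (f : E -> R) (z : E) : E :=
  xget 0 [set g | is_gradient L f z g].

(* State (x_k, r_k, p_k) -- iterate, residual, search direction -- after k steps
   of the conjugate gradient method for M x = rhs, started at x_0 = 0.  As
   0 / 0 = 0, the state is stationary once the residual vanishes. *)
Fixpoint cg_state (M : E -> E) (rhs : E) (k : nat) : E * E * E :=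
  if k is k'.+1 then
    let: (x, r, p) := cg_state M rhs k' in
    let a := pdot r r / pdot p (M p) in
    let r' := r - a *: M p in
    let c := pdot r' r' / pdot r r in
    (x + a *: p, r', r' + c *: p)
  else (0, rhs, rhs).

Definition cg_iterate (M : E -> E) (rhs : E) (k : nat) : E :=
  (cg_state M rhs k).1.1.

End InnerProducts.

Section SymmetricMatrices.
Variables (R : realType) (n : nat).

Definition symS : set 'M[R]_n := [set X | X^T = X].

Definition psdS : set 'M[R]_n :=
  [set X | symS X /\ forall v : 'cV[R]_n, 0 <= (v^T *m X *m v) 0 0].

Definition pdS : set 'M[R]_n :=
  [set X | symS X /\ forall v : 'cV[R]_n, v != 0 -> 0 < (v^T *m X *m v) 0 0].

Definition psd_proj (X : 'M[R]_n) : 'M[R]_n :=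
  xget 0 [set Y | psdS Y /\ forall Z, psdS Z -> mxfnorm (X - Y) <= mxfnorm (X - Z)].

Definition tangent_cone (K : set 'M[R]_n) (Y : 'M[R]_n) : set 'M[R]_n :=
  [set H | exists (t : nat -> R) (D : nat -> 'M[R]_n),
    [/\ forall k, 0 < t k, t @ \oo --> (0 : R), D @ \oo --> H
      & forall k, K (Y + t k *: D k)]].

(* The union of all linear subspaces contained in K; when K is a convex cone
   this union is itself a subspace, hence the largest one. *)
Definition lineality (K : set 'M[R]_n) : set 'M[R]_n :=
  [set H | exists2 V : {vspace 'M[R]_n}, [set` V] `<=` K & H \in V].

Definition eigen_decomp (X P : 'M[R]_n) (lam : 'rV[R]_n) : Prop :=
  [/\ P^T *m P = 1%:M, X = P *m diag_mx lam *m P^T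
    & forall i j : 'I_n, (i <= j)%N -> lam 0 j <= lam 0 i].

Definition Sigma_mx (lam : 'rV[R]_n) : 'M[R]_n :=
  \matrix_(i, j)
    if 0 < lam 0 i then
      if 0 < lam 0 j then 1 else lam 0 i / (lam 0 i - lam 0 j)
    else
      if 0 < lam 0 j then lam 0 j / (lam 0 j - lam 0 i) else 0.

Definition U_op (P : 'M[R]_n) (lam : 'rV[R]_n) (H : 'M[R]_n) : 'M[R]_n :=
  P *m map2_mx *%R (Sigma_mx lam) (P^T *m H *m P) *m P^T.

End SymmetricMatrices.

Section Algorithm.
Variables (R : realType) (m n : nat).
Local Notation E := ('M[R]_n * 'cV[R]_m)%type.

Variables (Q : {linear 'M[R]_n -> 'M[R]_n}) (A : {linear 'M[R]_n -> 'cV[R]_m}).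
Variables (Aadj : {linear 'cV[R]_m -> 'M[R]_n}).
Variables (b : 'cV[R]_m) (Chat : 'M[R]_n) (sigma : R).

Definition S_map (z : E) : 'M[R]_n := Aadj z.2 - Q z.1 - Chat.

Definition phi (z : E) : R :=
  2^-1 * mxdot z.1 (Q z.1) - mxdot b z.2
  + sigma / 2 * mxfnorm (psd_proj (S_map z)) ^+ 2.

Definition phi_dom : set E := (Q @` @symS R n) `*` setT.

(* Under the standing assumptions on Q, A and its adjoint, this is
   (Q W - sigma Q Pi(S(W, y)), - b + sigma A Pi(S(W, y))). *)
Definition grad_phi : E -> E := gradient phi_dom phi.

Definition V_op (P : 'M[R]_n) (lam : 'rV[R]_n) (d : E) : E :=
  let G := U_op P lam (Q d.1 - Aadj d.2) in
  (Q d.1 + sigma *: Q G, - (sigma *: A G)).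

Definition V_reg (P : 'M[R]_n) (lam : 'rV[R]_n) (eps : R) (d : E) : E :=
  V_op P lam d + eps *: (0, d.2).

Variables mu etabar tau tau1 tau2 delta : R.

Definition armijo (z d : E) (k : nat) : Prop :=
  phi (z + delta ^+ k *: d)
    <= phi z + mu * delta ^+ k * pdot (grad_phi z) d.

(* Any CG iterate that meets the residual tolerance may be accepted as d. *)
Definition sncg_step (z z' : E) : Prop :=
  let g := grad_phi z in
  let eps := tau1 * Num.min tau2 (pnorm g) in
  let eta := Num.min etabar (pnorm g `^ (1 + tau)) in
  exists (P : 'M[R]_n) (lam : 'rV[R]_n) (k : nat) (d : E) (mj : nat),
    eigen_decomp (S_map z) P lam /\
    d = cg_iterate (V_reg P lam eps) (- g) k /\
    phi_dom d /\
    pnorm (V_reg P lam eps d + g) <= eta /\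
    armijo z d mj /\ (forall l : nat, (l < mj)%N -> ~ armijo z d l) /\
    z' = z + delta ^+ mj *: d.

Definition sncg_sequence (z : nat -> E) : Prop :=
  phi_dom (z 0%N) /\ forall j : nat, sncg_step (z j) (z j.+1).

End Algorithm.

(* Main.v *)
Require Import Defs.
From mathcomp Require Import all_boot all_order all_algebra.
From mathcomp Require Import all_classical all_reals all_analysis.
From mathcomp Require Import ring lra.
Set Implicit Arguments.
Unset Strict Implicit.
Unset Printing Implicit Defensive.
Import Order.TTheory GRing.Theory Num.Theory.
Import numFieldNormedType.Exports.
Local Open Scope classical_set_scope.
Local Open Scope ring_scope.

(* Write Z = Pi(X), N = Z - X and D = Y - X.  Two expansions of the projection at a
   fixed X, both valid for every Y, carry the argument: in an eigenbasis of Y the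
   relations Z N = 0 and Y = Z - N + D give
   |Pi(Y) - Pi(X) - U_Y(Y - X)| <= K |Y - X|^2, and in an eigenbasis of X they give the
   trapezoidal rule |<Pi(Y), X> - <Pi(X), Y>| <= K |Y - X|^3.
   Constraint nondegeneracy says that y |-> Pi(S) A^* y is injective; since
   |Pi(Y) H|^2 <= 2 |Y|^2 <H, U_Y H>, it makes the operators V_j uniformly positive
   definite near the accumulation point.  Every CG iterate decreases the quadratic
   model, hence is a descent direction, so the Armijo decrease is bounded below near an
   accumulation point at which the gradient does not vanish; the accumulation point is
   therefore stationary.  Near it the direction d_j satisfies
   |z_j + d_j - zbar| = O(|z_j - zbar|^(1+tau)), and the trapezoidal rule together with
   mu < 1/2 makes the unit step pass the Armijo test, so the iterates contract. *)

(** The operators [V_j] are built from the eigenvalues of [S(W^j, y^j)], which may collide or cross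
    0 as the iterates approach the limit, so no estimate may rest on their gaps. This is why both
    expansions fix X, the value of S at the limit: their constants depend only on n and on the
    reciprocals of the nonzero eigenvalues of X, and complementarity replaces perturbation theory
    for eigenvectors. As phi need not be twice differentiable, no second-order Taylor formula at the
    limit is at hand for the Armijo test; the trapezoidal rule gives third-order accuracy from the
    gradients at both endpoints. The regularisation has two roles: [eps_j > 0] makes the operator
    definite wherever the gradient is nonzero, so that CG yields descent far from the limit as well,
    and [eps_j <= |grad|] makes its effect near the limit second order. The bound [etabar < 1] and
    the exponent [1 + tau > 1] keep the residual strictly below the gradient norm, so the direction
    cannot shrink while the gradient stays away from 0. *)

Section SemiInnerProduct.
Variables (R : realType) (V : lmodType R) (dot : V -> V -> R).
Hypothesis dotC : forall u v, dot u v = dot v u.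
Hypothesis dotD : forall u v w, dot (u + v) w = dot u w + dot v w.
Hypothesis dotZ : forall a u w, dot (a *: u) w = a * dot u w.
Hypothesis dot_ge0 : forall u, 0 <= dot u u.

Let nrm u := Num.sqrt (dot u u).

(** Definiteness is not assumed, because besides the trace inner product this serves the forms of
    [psd_CS] and [Q_CS]. When [dot v v = 0] the quadratic in [t] is affine, and nonnegativity forces
    a zero slope. *)
Lemma semidot_CS u v : dot u v ^+ 2 <= dot u u * dot v v.
Proof.
have H t : 0 <= dot u u + 2 * t * dot u v + t ^+ 2 * dot v v.
  have := dot_ge0 (u + t *: v).
  rewrite dotD dotZ 2![dot _ (u + _)]dotC !dotD !dotZ (dotC v u).
  by move=> h; apply: le_trans h _; rewrite le_eqVlt; apply/orP; left; apply/eqP; ring.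
have [c0|c0] := eqVneq (dot v v) 0.
  have [->|b0] := eqVneq (dot u v) 0; first by rewrite c0 expr2 !mulr0.
  have := H (- (dot u u + 1) / (2 * dot u v)); rewrite c0 mulr0 addr0.
  have -> : 2 * (- (dot u u + 1) / (2 * dot u v)) * dot u v = - (dot u u + 1).
    by field.
  lra.
have cp : 0 < dot v v by rewrite lt0r c0 dot_ge0.
have := H (- dot u v / dot v v).
have -> : dot u u + 2 * (- dot u v / dot v v) * dot u v
   + (- dot u v / dot v v) ^+ 2 * dot v v = (dot u u * dot v v - dot u v ^+ 2) / dot v v.
  by field.
by rewrite pmulr_lge0 ?invr_gt0// subr_ge0.
Qed.

Lemma semidot_normCS u v : `|dot u v| <= nrm u * nrm v.
Proof.
rewrite -sqrtrM// -sqrtr_sqr; apply: ler_wsqrtr; exact: semidot_CS.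
Qed.

Lemma seminrmD u v : nrm (u + v) <= nrm u + nrm v.
Proof.
rewrite -(@ler_pXn2r _ 2)// ?nnegrE ?addr_ge0 ?sqrtr_ge0//.
rewrite sqrrD !sqr_sqrtr// dotD 2![dot _ (u + _)]dotC !dotD (dotC v u).
have := ler_norm (dot u v); have := semidot_normCS u v; lra.
Qed.

Lemma seminrmZ a u : nrm (a *: u) = `|a| * nrm u.
Proof.
rewrite /nrm dotZ dotC dotZ mulrA -expr2 sqrtrM ?sqr_ge0//.
by rewrite sqrtr_sqr.
Qed.

End SemiInnerProduct.

(** * Trace inner product, Frobenius norm and bounds for linear maps *)

Section MatrixInnerProduct.
Variable R : realType.
Implicit Types p q : nat.

Lemma mxdotE p q (X Y : 'M[R]_(p, q)) : mxdot X Y = \sum_i \sum_j X i j * Y i j.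
Proof.
rewrite /mxdot /mxtrace exchange_big; apply: eq_bigr => j _.
by rewrite !mxE; apply: eq_bigr => i _; rewrite !mxE.
Qed.

Lemma mxdotC p q (X Y : 'M[R]_(p, q)) : mxdot X Y = mxdot Y X.
Proof. by rewrite /mxdot -mxtrace_tr trmx_mul trmxK. Qed.

Lemma mxdotDl p q (X Y Z : 'M[R]_(p, q)) : mxdot (X + Y) Z = mxdot X Z + mxdot Y Z.
Proof. by rewrite /mxdot linearD /= mulmxDl mxtraceD. Qed.

Lemma mxdotZl p q a (X Y : 'M[R]_(p, q)) : mxdot (a *: X) Y = a * mxdot X Y.
Proof. by rewrite /mxdot linearZ /= -scalemxAl mxtraceZ. Qed.

Lemma mxdotDr p q (X Y Z : 'M[R]_(p, q)) : mxdot Z (X + Y) = mxdot Z X + mxdot Z Y.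
Proof. by rewrite !(mxdotC Z) mxdotDl. Qed.

Lemma mxdotZr p q a (X Y : 'M[R]_(p, q)) : mxdot Y (a *: X) = a * mxdot Y X.
Proof. by rewrite !(mxdotC Y) mxdotZl. Qed.

Lemma mxdotNl p q (X Y : 'M[R]_(p, q)) : mxdot (- X) Y = - mxdot X Y.
Proof. by rewrite -scaleN1r mxdotZl mulN1r. Qed.

Lemma mxdotNr p q (X Y : 'M[R]_(p, q)) : mxdot X (- Y) = - mxdot X Y.
Proof. by rewrite !(mxdotC X) mxdotNl. Qed.

Lemma mxdotBl p q (X Y Z : 'M[R]_(p, q)) : mxdot (X - Y) Z = mxdot X Z - mxdot Y Z.
Proof. by rewrite mxdotDl mxdotNl. Qed.

Lemma mxdotBr p q (X Y Z : 'M[R]_(p, q)) : mxdot Z (X - Y) = mxdot Z X - mxdot Z Y.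
Proof. by rewrite mxdotDr mxdotNr. Qed.

Lemma mxdot0l p q (X : 'M[R]_(p, q)) : mxdot 0 X = 0.
Proof. by rewrite -(scale0r 0) mxdotZl mul0r. Qed.

Lemma mxdot0r p q (X : 'M[R]_(p, q)) : mxdot X 0 = 0.
Proof. by rewrite mxdotC mxdot0l. Qed.

Lemma mxdot_ge0 p q (X : 'M[R]_(p, q)) : 0 <= mxdot X X.
Proof.
by rewrite mxdotE; do 2!apply: sumr_ge0 => ? _; rewrite -expr2 sqr_ge0.
Qed.

Lemma sqr_mxfnorm p q (X : 'M[R]_(p, q)) : mxfnorm X ^+ 2 = mxdot X X.
Proof. by rewrite sqr_sqrtr// mxdot_ge0. Qed.

Lemma mxfnorm_ge0 p q (X : 'M[R]_(p, q)) : 0 <= mxfnorm X.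
Proof. exact: sqrtr_ge0. Qed.

Lemma mxdot_CS p q (X Y : 'M[R]_(p, q)) : `|mxdot X Y| <= mxfnorm X * mxfnorm Y.
Proof.
exact: (semidot_normCS (@mxdotC p q) (@mxdotDl p q) (@mxdotZl p q) (@mxdot_ge0 p q)).
Qed.

Lemma mxfnormD p q (X Y : 'M[R]_(p, q)) : mxfnorm (X + Y) <= mxfnorm X + mxfnorm Y.
Proof.
exact: (seminrmD (@mxdotC p q) (@mxdotDl p q) (@mxdotZl p q) (@mxdot_ge0 p q)).
Qed.

Lemma mxfnormZ p q a (X : 'M[R]_(p, q)) : mxfnorm (a *: X) = `|a| * mxfnorm X.
Proof. exact: (seminrmZ (@mxdotC p q) (@mxdotZl p q)). Qed.

Lemma mxfnormN p q (X : 'M[R]_(p, q)) : mxfnorm (- X) = mxfnorm X.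
Proof. by rewrite -scaleN1r mxfnormZ normrN1 mul1r. Qed.

Lemma mxfnormB p q (X Y : 'M[R]_(p, q)) : mxfnorm (X - Y) <= mxfnorm X + mxfnorm Y.
Proof. by rewrite (le_trans (mxfnormD _ _))// mxfnormN. Qed.

Lemma mxfnorm0 p q : mxfnorm (0 : 'M[R]_(p, q)) = 0.
Proof. by rewrite /mxfnorm mxdot0l sqrtr0. Qed.

Lemma mxentry_le_fnorm p q (X : 'M[R]_(p, q)) i j : `|X i j| <= mxfnorm X.
Proof.
rewrite -sqrtr_sqr; apply: ler_wsqrtr; rewrite mxdotE (bigD1 i)//= (bigD1 j)//=.
rewrite -expr2 -addrA lerDl addr_ge0//; first by apply: sumr_ge0 => ? _; rewrite -expr2 sqr_ge0.
by do 2!apply: sumr_ge0 => ? _; rewrite -expr2 sqr_ge0.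
Qed.

Lemma mxfnorm_eq0 p q (X : 'M[R]_(p, q)) : mxfnorm X = 0 -> X = 0.
Proof.
move=> X0; apply/matrixP => i j; rewrite mxE; apply/eqP.
by rewrite -normr_le0 -X0 mxentry_le_fnorm.
Qed.

Lemma mxdot_eq0 p q (X : 'M[R]_(p, q)) : mxdot X X = 0 -> X = 0.
Proof. by move=> X0; apply: mxfnorm_eq0; rewrite /mxfnorm X0 sqrtr0. Qed.

Lemma mxfnorm_sum p q (I : finType) (F : I -> 'M[R]_(p, q)) :
  mxfnorm (\sum_i F i) <= \sum_i mxfnorm (F i).
Proof.
apply: (big_ind2 (fun X a => mxfnorm X <= a)) => [|X a Y b Xa Yb|//].
  by rewrite mxfnorm0.
exact: le_trans (mxfnormD _ _) (lerD Xa Yb).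
Qed.

Lemma mxfnorm_delta p q i j : mxfnorm (delta_mx i j : 'M[R]_(p, q)) = 1.
Proof.
rewrite /mxfnorm mxdotE (bigD1 i)//= (bigD1 j)//= !mxE !eqxx mulr1.
rewrite !big1 ?addr0 ?sqrtr1// => [k ki|k kj].
  by apply: big1 => l _; rewrite !mxE (negPf ki) mul0r.
by rewrite !mxE (negPf kj) andbF mul0r.
Qed.

Lemma mxfnorm_le_sum p q (X : 'M[R]_(p, q)) :
  mxfnorm X <= \sum_i \sum_j `|X i j|.
Proof.
rewrite {1}(matrix_sum_delta X) (le_trans (mxfnorm_sum _))//.
apply: ler_sum => i _; rewrite (le_trans (mxfnorm_sum _))//.
by apply: ler_sum => j _; rewrite mxfnormZ mxfnorm_delta mulr1.
Qed.

Lemma mxfnorm_le_max p q (X : 'M[R]_(p, q)) c :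
  (forall i j, `|X i j| <= c) -> mxfnorm X <= (p * q)%:R * c.
Proof.
move=> Xc; rewrite (le_trans (mxfnorm_le_sum X))//.
rewrite (@le_trans _ _ (\sum_(i < p) \sum_(j < q) c))//.
  by apply: ler_sum => i _; exact: ler_sum.
by rewrite !sumr_const !card_ord -mulrnA mulr_natl mulnC.
Qed.

Lemma mxfnorm_le p q p' q' (X : 'M[R]_(p, q)) (Y : 'M[R]_(p', q')) :
  (mxfnorm X <= mxfnorm Y) = (mxdot X X <= mxdot Y Y).
Proof. by rewrite ler_sqrt// mxdot_ge0. Qed.

Lemma mxdot_mull p q r (X : 'M[R]_(p, q)) (Y : 'M[R]_(q, r)) (Z : 'M[R]_(p, r)) :
  mxdot (X *m Y) Z = mxdot Y (X^T *m Z).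
Proof. by rewrite /mxdot trmx_mul mulmxA. Qed.

Lemma mxdot_mulr p q r (X : 'M[R]_(p, q)) (Y : 'M[R]_(q, r)) (Z : 'M[R]_(p, r)) :
  mxdot (X *m Y) Z = mxdot X (Z *m Y^T).
Proof.
by rewrite /mxdot trmx_mul -mulmxA mxtrace_mulC mulmxA.
Qed.

Lemma mxdot_tr p q (X Y : 'M[R]_(p, q)) : mxdot X^T Y^T = mxdot X Y.
Proof. by rewrite /mxdot trmxK -mxtrace_tr trmx_mul trmxK mxtrace_mulC. Qed.

Lemma mxfnorm_tr p q (X : 'M[R]_(p, q)) : mxfnorm X^T = mxfnorm X.
Proof. by rewrite /mxfnorm mxdot_tr. Qed.

Lemma mxdot_col p q (X Y : 'M[R]_(p, q)) : mxdot X Y = \sum_j mxdot (col j X) (col j Y).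
Proof.
rewrite mxdotE exchange_big; apply: eq_bigr => j _; rewrite mxdotE.
by apply: eq_bigr => i _; rewrite big_ord1 !mxE.
Qed.

Lemma mxdot_row p q (X Y : 'M[R]_(p, q)) : mxdot X Y = \sum_i mxdot (row i X) (row i Y).
Proof.
rewrite mxdotE; apply: eq_bigr => j _; rewrite mxdotE big_ord1.
by apply: eq_bigr => i _; rewrite !mxE.
Qed.

Lemma mxfnorm_col p q (X : 'M[R]_(p, q)) j : mxfnorm (col j X) <= mxfnorm X.
Proof.
rewrite mxfnorm_le (mxdot_col X) (bigD1 j)//= lerDl.
by apply: sumr_ge0 => *; exact: mxdot_ge0.
Qed.

Lemma mxfnormM p q r (X : 'M[R]_(p, q)) (Y : 'M[R]_(q, r)) :
  mxfnorm (X *m Y) <= mxfnorm X * mxfnorm Y.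
Proof.
rewrite -(@ler_pXn2r _ 2)// ?nnegrE ?mulr_ge0 ?mxfnorm_ge0//.
rewrite exprMn !sqr_mxfnorm.
rewrite (mxdotE (X *m Y)) (mxdot_row X) (mxdot_col Y) mulr_suml.
apply: ler_sum => i _; rewrite mulr_sumr; apply: ler_sum => j _.
have -> : (X *m Y) i j = mxdot (row i X) (col j Y)^T.
  by rewrite mxE mxdotE big_ord1; apply: eq_bigr => k _; rewrite !mxE.
rewrite -expr2 -(mxdot_tr (col j Y)).
exact: (semidot_CS (@mxdotC _ _) (@mxdotDl _ _) (@mxdotZl _ _) (@mxdot_ge0 _ _)).
Qed.

Lemma linear_bounded p q p' q' (f : {linear 'M[R]_(p, q) -> 'M[R]_(p', q')}) :
  exists2 K, 0 <= K & forall X, mxfnorm (f X) <= K * mxfnorm X.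
Proof.
exists (\sum_i \sum_j mxfnorm (f (delta_mx i j))).
  by do 2!apply: sumr_ge0 => *; exact: mxfnorm_ge0.
move=> X; rewrite {1}(matrix_sum_delta X) linear_sum.
rewrite (le_trans (mxfnorm_sum _))// mulr_suml; apply: ler_sum => i _.
rewrite linear_sum (le_trans (mxfnorm_sum _))// mulr_suml; apply: ler_sum => j _.
by rewrite linearZ mxfnormZ mulrC ler_wpM2l ?mxfnorm_ge0 ?mxentry_le_fnorm.
Qed.

(** A generalised inverse. Being linear, hence bounded, it supplies preimages whose norm is
    controlled. *)
Lemma linear_section p q p' q' (f : {linear 'M[R]_(p, q) -> 'M[R]_(p', q')}) :
  exists g : {linear 'M[R]_(p', q') -> 'M[R]_(p, q)}, forall X, f (g (f X)) = f X.
Proof.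
pose h := (linfun f)^-1%VF; exists h => X.
have := limg_lfunVK (memv_img (linfun f) (memvf X)).
by rewrite !lfunE.
Qed.

(** A section of an injective map is a left inverse, so its operator bound [K] yields the constant
    [1 / (K + 1)]. *)
Lemma linear_inj_bounded_below p q p' q' (f : {linear 'M[R]_(p, q) -> 'M[R]_(p', q')}) :
  (forall X, f X = 0 -> X = 0) ->
  exists2 c, 0 < c & forall X, c * mxfnorm X <= mxfnorm (f X).
Proof.
move=> f0; have [g fg] := linear_section f; have [K K0 gK] := linear_bounded g.
have gf X : g (f X) = X.
  by apply/eqP; rewrite -subr_eq0; apply/eqP/f0; rewrite linearB /= fg subrr.
exists (K + 1)^-1; first by rewrite invr_gt0 ltr_wpDl.
move=> X; rewrite mulrC ler_pdivrMr ?ltr_wpDl//.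
have := gK (f X); rewrite gf => /le_trans; apply.
by rewrite mulrC ler_wpM2l ?mxfnorm_ge0// lerDl.
Qed.

End MatrixInnerProduct.

(** * Spectral theorem for real symmetric matrices *)

Section Spectral.
Variable R : realType.

Lemma entry_mulmx_trmx p q r (P : 'M[R]_(p, q)) (Y : 'M[R]_(p, r)) i j :
  (P^T *m Y) i j = mxdot (col i P) (col j Y).
Proof.
by rewrite mxE mxdotE; apply: eq_bigr => k _; rewrite big_ord1 !mxE.
Qed.

Lemma entry_congr p q (P : 'M[R]_(p, q)) (X : 'M[R]_p) i j :
  (P^T *m X *m P) i j = mxdot (col i P) (X *m col j P).
Proof. by rewrite -mulmxA entry_mulmx_trmx colE -!colE !colE -mulmxA. Qed.

Lemma mxdot_delta n (X : 'M[R]_n) (i j : 'I_n) :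
  mxdot (delta_mx i 0 : 'cV_n) (X *m delta_mx j 0) = X i j.
Proof.
rewrite -colE mxdotE (bigD1 i)//= big_ord1 !mxE eqxx mul1r big1 ?addr0// => k ki.
by rewrite big_ord1 !mxE (negPf ki) mul0r.
Qed.

Lemma mxdot_delta1 n (i j : 'I_n) :
  mxdot (delta_mx i 0 : 'cV[R]_n) (delta_mx j 0) = (i == j)%:R.
Proof. by rewrite -[X in mxdot _ X]mul1mx mxdot_delta mxE. Qed.

(** The orthogonal group is compact: its columns are unit vectors and polynomial equations cut it
    out. Matrices pass through [vec_mx] so that compactness is that of closed bounded sets of row
    vectors. *)
Lemma orthogonal_EVT n (f : 'M[R]_n -> R) :
  continuous (fun v => f (vec_mx v)) ->
  exists2 P, P^T *m P = 1%:M & forall P', P'^T *m P' = 1%:M -> f P' <= f P.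
Proof.
move=> fc.
pose A := [set v : 'rV[R]_(n * n) | (vec_mx v)^T *m vec_mx v = 1%:M].
have cA : compact A.
  apply: bounded_closed_compact.
    exists 1; split => // M M1 v /= vA.
    rewrite /Num.Def.normr/= mx_normrE; apply/bigmax_leP; split => /= [|[i0 k] _].
      by rewrite (le_trans ler01) ?ltW.
    rewrite ord1 /=; case/mxvec_indexP: k => i j.
    have -> : v 0 (mxvec_index i j) = vec_mx v i j by rewrite mxE.
    apply: le_trans (ltW M1).
    have := congr1 (fun M : 'M[R]_n => M j j) vA.
    rewrite entry_mulmx_trmx mxE eqxx -sqr_mxfnorm => /eqP.
    rewrite sqrf_eq1 => /orP[/eqP h|/eqP h].
      have := mxentry_le_fnorm (col j (vec_mx v)) i 0.
      by rewrite h mxE.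
    by have := mxfnorm_ge0 (col j (vec_mx v)); rewrite h; lra.
  rewrite (_ : A = \bigcap_(ij : 'I_n * 'I_n)
    ((fun v : 'rV[R]_(n * n) => ((vec_mx v)^T *m vec_mx v) ij.1 ij.2) @^-1`
       [set x | x = (1%:M : 'M[R]_n) ij.1 ij.2])); last first.
    apply/seteqP; split => v /= vA; first by move=> ij _ /=; rewrite vA.
    by apply/matrixP => i j; exact: (vA (i, j)).
  apply: closed_bigI => -[i j] _ /=; apply: preimage_closed; last exact: closed_eq.
  move=> v _; rewrite (_ : (fun _ => _) = fun v : 'rV[R]_(n * n) =>
      \sum_k v 0 (mxvec_index k i) * v 0 (mxvec_index k j)); last first.
    by apply/funext => u; rewrite mxE; apply: eq_bigr => k _; rewrite !mxE.
  apply: (@continuous_big _ _ _ _ _ (@add_continuous _)) => k _.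
  by move=> u; apply: continuousM; exact: coord_continuous.
have [||v vA vmax] := compact_EVT_max (f := fun v => f (vec_mx v)) _ cA.
- exists (mxvec 1%:M); rewrite /A /= mxvecK trmx1 mulmx1//.
- by move=> v; apply: continuous_subspaceT.
exists (vec_mx v); first by rewrite inE in vA.
move=> P' P'1; have := vmax (mxvec P'); rewrite mxvecK; apply.
by rewrite inE /A /= mxvecK.
Qed.

Definition givens n (i j : 'I_n) (c s : R) : 'M[R]_n :=
  \matrix_(k, l) (if l == i then c *: delta_mx i 0 + s *: delta_mx j 0
    else if l == j then (- s) *: delta_mx i 0 + c *: delta_mx j 0
    else delta_mx l 0 : 'cV[R]_n) k 0.

Lemma col_givens n (i j : 'I_n) (c s : R) l :
  col l (givens i j c s) =
  if l == i then c *: delta_mx i 0 + s *: delta_mx j 0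
    else if l == j then (- s) *: delta_mx i 0 + c *: delta_mx j 0
    else delta_mx l 0 : 'cV[R]_n.
Proof. by apply/matrixP => k z; rewrite !ord1 !mxE. Qed.

Lemma givens_orthogonal n (i j : 'I_n) (c s : R) : i != j ->
  c ^+ 2 + s ^+ 2 = 1 -> (givens i j c s)^T *m givens i j c s = 1%:M.
Proof.
move=> ij cs; apply/matrixP => k l; rewrite entry_mulmx_trmx !col_givens mxE.
have ji : j != i by rewrite eq_sym.
have [ki|ki] := eqVneq k i; have [li|li] := eqVneq l i;
  try (have [kj|kj] := eqVneq k j); try (have [lj|lj] := eqVneq l j);
  rewrite ?(mxdotDl, mxdotDr, mxdotZl, mxdotZr) !mxdot_delta1; subst;
  rewrite ?eqxx ?(negPf ij) ?(negPf ji) ?(negPf ki) ?(negPf kj) ?(negPf li)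
    ?(negPf lj) ?[i == _]eq_sym ?[j == _]eq_sym ?(negPf ki) ?(negPf kj) ?(negPf li)
    ?(negPf lj) ?(negPf ij) ?(negPf ji) /= ?mulr1n ?mulr0n;
  first [by rewrite eqxx in ij | by rewrite -[RHS]cs; ring | ring].
Qed.

(** First-order optimality at [t = 0]: a small [t] of the sign of [b] would make the product
    positive if [b] were nonzero. *)
Lemma sqr_small_eq0 (b g : R) :
  (forall t, t * (b * (1 - t ^+ 2) + g * t) <= 0) -> b = 0.
Proof.
move=> H; apply/eqP/negP => /negP b0.
(* Chosen so that [2 u (|b| + |g|) = |b|]; then [u <= 1/2] and
   [|g| u <= |b| / 2 < |b| (1 - u^2)]. *)
pose u := (2 * (1 + `|g| / `|b|))^-1.
have bp : 0 < `|b| by rewrite normr_gt0.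
have d0 : 0 < 2 * (1 + `|g| / `|b|).
  by rewrite mulr_gt0// ltr_pwDl// divr_ge0.
have u0 : 0 < u by rewrite invr_gt0.
have u1 : u * (2 * (`|b| + `|g|)) = `|b|.
  rewrite /u; field; rewrite (gt_eqF bp)/= gt_eqF//.
  by rewrite ltr_pwDl.
have := H (Num.sg b * u).
rewrite exprMn sqr_sg b0 mul1r.
have -> : Num.sg b * u * (b * (1 - u ^+ 2) + g * (Num.sg b * u)) =
   u * (`|b| * (1 - u ^+ 2) + g * u * Num.sg b ^+ 2).
  by rewrite normrEsg; ring.
rewrite sqr_sg b0 mulr1 pmulr_rle0//.
have : - `|g| <= g by rewrite lerNl -normrN ler_norm.
move=> g1 h; have g0 : 0 <= `|g| by []; move: (`|g|) (`|b|) bp g0 u1 g1 h => {}G {}B *.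
nra.
Qed.

(* A maximiser over the orthogonal group of [sum_k k (P^T X P)_kk], whose weights are
   pairwise distinct, diagonalises X: otherwise some Givens rotation would improve it. *)
Lemma sym_orthogonal_diag n (X : 'M[R]_n) : symS X ->
  exists (P : 'M[R]_n) (lam : 'rV[R]_n),
    P^T *m P = 1%:M /\ X = P *m diag_mx lam *m P^T.
Proof.
move=> Xs.
pose f (P : 'M[R]_n) := \sum_(k < n) k%:R * (P^T *m X *m P) k k.
have [|P P1 Pmax] := @orthogonal_EVT n f.
  rewrite (_ : (fun _ => _) = fun v : 'rV[R]_(n * n) => \sum_(k < n)
      \sum_(a < n) \sum_(b < n)
        v 0 (mxvec_index a k) * v 0 (mxvec_index b k) * (k%:R * X a b)); last first.
    apply/funext => v; rewrite /f; apply: eq_bigr => k _.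
    rewrite entry_congr mxdotE mulr_sumr; apply: eq_bigr => a _.
    rewrite big_ord1 !mxE mulrA mulr_sumr; apply: eq_bigr => b _.
    by rewrite !mxE; ring.
  do 3!apply: (@continuous_big _ _ _ _ _ (@add_continuous _)) => ? _.
  have cM (u w : 'rV[R]_(n * n) -> R) : continuous u -> continuous w ->
      continuous (fun v => u v * w v).
    by move=> cu cw v; apply: continuousM; [exact: cu|exact: cw].
  apply: (cM); last exact: cst_continuous.
  by apply: cM; exact: coord_continuous.
pose B := P^T *m X *m P.
have PP : P *m P^T = 1%:M by exact: mulmx1C.
have Bs i j : B i j = B j i.
  have {1}<- : B^T = B by rewrite /B !trmx_mul trmxK Xs mulmxA.
  by rewrite mxE.
have offd i j : i != j -> B i j = 0.
  move=> ij; have ji : j != i by rewrite eq_sym.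
  suff H (c s : R) : c ^+ 2 + s ^+ 2 = 1 ->
      (i%:R - j%:R) * (s ^+ 2 * (B j j - B i i) + 2 * c * s * B i j) <= 0.
    have ijR : (i%:R - j%:R : R) != 0 by rewrite subr_eq0 eqr_nat.
    suff : (i%:R - j%:R) * B i j = 0 by move=> /eqP; rewrite mulf_eq0 (negPf ijR) => /eqP.
    apply: (@sqr_small_eq0 _ ((i%:R - j%:R) * (B j j - B i i))) => t.
    have t0 : 0 < 1 + t ^+ 2 by rewrite ltr_pwDl// sqr_ge0.
    (* The rational parametrisation of the circle turns the variation into a positive factor times
       the polynomial of [sqr_small_eq0]. *)
    have := H ((1 - t ^+ 2) / (1 + t ^+ 2)) (2 * t / (1 + t ^+ 2)).
    have -> : ((1 - t ^+ 2) / (1 + t ^+ 2)) ^+ 2 + (2 * t / (1 + t ^+ 2)) ^+ 2 = 1.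
      by field; rewrite gt_eqF.
    move=> /(_ erefl).
    have -> : (i%:R - j%:R) * ((2 * t / (1 + t ^+ 2)) ^+ 2 * (B j j - B i i)
       + 2 * ((1 - t ^+ 2) / (1 + t ^+ 2)) * (2 * t / (1 + t ^+ 2)) * B i j) =
     t * ((i%:R - j%:R) * B i j * (1 - t ^+ 2) + (i%:R - j%:R) * (B j j - B i i) * t) *
       (4 / (1 + t ^+ 2) ^+ 2).
      by field; rewrite gt_eqF.
    by rewrite pmulr_lle0// divr_gt0// exprn_gt0.
  move=> cs; pose G := givens i j c s.
  have G1 : G^T *m G = 1%:M by exact: givens_orthogonal.
  have := Pmax (P *m G); rewrite trmx_mul mulmxA -(mulmxA G^T) P1 mulmx1 => /(_ G1).
  rewrite /f -subr_le0 -sumrB.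
  have -> : (P *m G)^T *m X *m (P *m G) = G^T *m B *m G.
    by rewrite trmx_mul /B !mulmxA.
  rewrite -/B (bigD1 i)//= (bigD1 j)//= big1 ?addr0; last first.
    move=> k /andP[ki kj]; rewrite entry_congr col_givens (negPf ki) (negPf kj).
    by rewrite mxdot_delta subrr.
  rewrite !(entry_congr G) /G !col_givens !eqxx (negPf ji).
  rewrite !mulmxDr -!scalemxAr !(mxdotDl, mxdotDr, mxdotZl, mxdotZr) !mxdot_delta.
  rewrite (Bs j i) => h; apply: le_trans h; rewrite le_eqVlt; apply/orP; left.
  rewrite -subr_eq0; move: (B i i) (B i j) (B j j) => bi bij bj.
  rewrite [X in X == 0](_ : _ = (i%:R * bi + j%:R * bj) * (1 - (c ^+ 2 + s ^+ 2))).
    by rewrite cs subrr mulr0.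
  ring.
exists P, (\row_k B k k); split => //.
suff <- : B = diag_mx (\row_k B k k).
  by rewrite /B !mulmxA PP mul1mx -mulmxA PP mulmx1.
apply/matrixP => i j; rewrite [RHS]mxE [X in X *+ _]mxE.
by have [->|ij] := eqVneq i j; rewrite ?mulr1n// mulr0n offd.
Qed.

End Spectral.

(** * Projection onto the positive semidefinite cone *)

Section Projection.
Variables (R : realType) (n : nat).
Implicit Types (X Y Z N P : 'M[R]_n) (lam : 'rV[R]_n).

Lemma qformE X (v : 'cV[R]_n) : (v^T *m X *m v) 0 0 = mxdot v (X *m v).
Proof. by rewrite /mxdot mulmxA trace_mx11. Qed.

Lemma psd_ge0 X : psdS X -> forall v : 'cV[R]_n, 0 <= mxdot v (X *m v).
Proof. by move=> [_ H] v; rewrite -qformE. Qed.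

Lemma psdI X : symS X -> (forall v : 'cV[R]_n, 0 <= mxdot v (X *m v)) -> psdS X.
Proof. by move=> Xs H; split=> // v; rewrite qformE. Qed.

Lemma symSD X Y : symS X -> symS Y -> symS (X + Y).
Proof. by rewrite /symS /= linearD /= => -> ->. Qed.

Lemma symSZ a X : symS X -> symS (a *: X).
Proof. by rewrite /symS /= linearZ /= => ->. Qed.

Lemma symSN X : symS X -> symS (- X).
Proof. by rewrite -scaleN1r; exact: symSZ. Qed.

Lemma symSB X Y : symS X -> symS Y -> symS (X - Y).
Proof. by move=> Xs Ys; apply: symSD => //; exact: symSN. Qed.

Lemma symS_congr m (P : 'M[R]_(n, m)) X : symS X -> symS (P^T *m X *m P).
Proof. by rewrite /symS /= !trmx_mul trmxK => ->; rewrite mulmxA. Qed.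

Lemma symSE X i j : symS X -> X i j = X j i.
Proof. by move=> Xs; rewrite -[in LHS]Xs mxE. Qed.

Lemma mxdot_symr X (u v : 'cV[R]_n) : symS X -> mxdot (X *m u) v = mxdot u (X *m v).
Proof. by move=> Xs; rewrite mxdot_mull Xs. Qed.

Lemma psd_congr X P : psdS X -> psdS (P^T *m X *m P).
Proof.
move=> Xp; apply: psdI; first by case: Xp => Xs _; exact: symS_congr.
by move=> v; rewrite -!mulmxA -mxdot_mull psd_ge0.
Qed.

Lemma psd_CS X (u v : 'cV[R]_n) : psdS X ->
  mxdot u (X *m v) ^+ 2 <= mxdot u (X *m u) * mxdot v (X *m v).
Proof.
move=> Xp; have Xs : symS X by case: Xp.
apply: (@semidot_CS R _ (fun u v => mxdot u (X *m v))) => *.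
- by rewrite -mxdot_symr// mxdotC.
- by rewrite mxdotDl.
- by rewrite mxdotZl.
- exact: psd_ge0.
Qed.

Lemma psd_diag_ge0 X i : psdS X -> 0 <= X i i.
Proof. by move=> Xp; rewrite -mxdot_delta psd_ge0. Qed.

Lemma psd_entry_CS X i j : psdS X -> X i j ^+ 2 <= X i i * X j j.
Proof. by move=> Xp; rewrite -!mxdot_delta; exact: psd_CS. Qed.

Lemma mxdot_diag lam Y : mxdot (diag_mx lam) Y = \sum_k lam 0 k * Y k k.
Proof.
rewrite mxdotE; apply: eq_bigr => i _; rewrite (bigD1 i)//= big1 ?addr0.
  by rewrite mxE eqxx mulr1n.
by move=> j ji; rewrite mxE eq_sym (negPf ji) mulr0n mul0r.
Qed.

Lemma mxdot_conj P X Y : mxdot (P *m X *m P^T) Y = mxdot X (P^T *m Y *m P).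
Proof. by rewrite mxdot_mulr mxdot_mull trmxK mulmxA. Qed.

Lemma orthoC P : P^T *m P = 1%:M -> P *m P^T = 1%:M.
Proof. exact: mulmx1C. Qed.

Lemma conjK P X : P^T *m P = 1%:M -> P^T *m (P *m X *m P^T) *m P = X.
Proof. by move=> P1; rewrite !mulmxA P1 mul1mx -mulmxA P1 mulmx1. Qed.

Lemma conjKV P X : P^T *m P = 1%:M -> P *m (P^T *m X *m P) *m P^T = X.
Proof. by move=> /orthoC P1; rewrite !mulmxA P1 mul1mx -mulmxA P1 mulmx1. Qed.

Lemma mxfnorm_conj P X : P^T *m P = 1%:M -> mxfnorm (P *m X *m P^T) = mxfnorm X.
Proof. by move=> P1; rewrite /mxfnorm mxdot_conj conjK. Qed.

Lemma mxfnorm_conjT P X : P^T *m P = 1%:M -> mxfnorm (P^T *m X *m P) = mxfnorm X.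
Proof. by move=> P1; rewrite -(mxfnorm_conj _ P1) conjKV. Qed.

Lemma psd_conj_diag P lam : (forall k, 0 <= lam 0 k) ->
  psdS (P *m diag_mx lam *m P^T).
Proof.
move=> l0; rewrite -{1}[P]trmxK; apply: psd_congr; apply: psdI => [|v].
  by rewrite /symS /= tr_diag_mx.
rewrite mxdotE; apply: sumr_ge0 => i _; rewrite big_ord1 mul_diag_mx mxE.
by rewrite mulrCA mulr_ge0// -expr2 sqr_ge0.
Qed.

Lemma psd_eigen_ge0 P lam : P^T *m P = 1%:M -> psdS (P *m diag_mx lam *m P^T) ->
  forall k, 0 <= lam 0 k.
Proof.
move=> P1 /(psd_congr P); rewrite conjK// => /psd_diag_ge0 H k.
by have := H k; rewrite mxE eqxx.
Qed.

(** In an eigenbasis of [X] the trace is a sum of eigenvalues of [X] times diagonal entries of a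
    conjugate of [Y]. *)
Lemma psd_dot_ge0 X Y : psdS X -> psdS Y -> 0 <= mxdot X Y.
Proof.
move=> Xp Yp; have [P [lam [P1 XE]]] := sym_orthogonal_diag Xp.1.
have l0 : forall k, 0 <= lam 0 k by apply: (psd_eigen_ge0 P1); rewrite -XE.
rewrite XE mxdot_conj mxdot_diag; apply: sumr_ge0 => k _.
by rewrite mulr_ge0// psd_diag_ge0//; exact: psd_congr.
Qed.

Lemma mxdot_sqrD X Y : mxdot (X + Y) (X + Y) = mxdot X X + 2 * mxdot X Y + mxdot Y Y.
Proof. by rewrite mxdotDl !mxdotDr (mxdotC Y X); ring. Qed.

(** Orthogonality gives [|Z - N - W|^2 = |N|^2 + 2 <N, W> + |Z - W|^2], where [<N, W> >= 0] for psd
    [W]; so [Z] is a minimiser, and the last term rules out any other. *)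
Lemma psd_proj_unique Z N : psdS Z -> psdS N -> mxdot Z N = 0 ->
  psd_proj (Z - N) = Z.
Proof.
move=> Zp Np ZN; apply: xget_unique.
  split=> // W Wp; rewrite mxfnorm_le.
  have -> : Z - N - Z = - N by rewrite addrAC subrr add0r.
  have -> : Z - N - W = - N + (Z - W) by rewrite addrAC addrC.
  rewrite (mxdot_sqrD (- N)) (mxdotNl N (Z - W)) mxdotBr (mxdotC N Z) ZN.
  have := psd_dot_ge0 Np Wp; have := mxdot_ge0 (Z - W); lra.
move=> Y [Yp /(_ Z Zp)]; rewrite mxfnorm_le.
have -> : Z - N - Z = - N by rewrite addrAC subrr add0r.
have -> : Z - N - Y = - N + (Z - Y) by rewrite addrAC addrC.
rewrite (mxdot_sqrD (- N)) (mxdotNl N (Z - Y)) mxdotBr (mxdotC N Z) ZN => h.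
have h2 := psd_dot_ge0 Np Yp; have h3 := mxdot_ge0 (Z - Y).
suff : mxdot (Z - Y) (Z - Y) = 0.
  by move/mxdot_eq0/eqP; rewrite subr_eq0 => /eqP.
lra.
Qed.

Lemma psd_proj_conj P lam : P^T *m P = 1%:M ->
  psd_proj (P *m diag_mx lam *m P^T) = P *m diag_mx (map_mx (Num.max 0) lam) *m P^T.
Proof.
move=> P1; pose Z := P *m diag_mx (map_mx (Num.max 0) lam) *m P^T.
pose N := P *m diag_mx (map_mx (fun x => Num.max 0 (- x)) lam) *m P^T.
have -> : P *m diag_mx lam *m P^T = Z - N.
  rewrite /Z /N -mulmxBl -mulmxBr -linearB; congr (_ *m diag_mx _ *m _).
  apply/matrixP => i j; rewrite !mxE !maxEle oppr_ge0.
  by case: (leP 0 (lam i j)) => ?; case: (leP (lam i j) 0) => ?; lra.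
apply: psd_proj_unique.
- by apply: psd_conj_diag => k; rewrite mxE le_max lexx.
- by apply: psd_conj_diag => k; rewrite mxE le_max lexx.
rewrite mxdot_conj conjK// mxdot_diag big1// => k _; rewrite !mxE eqxx mulr1n.
rewrite !maxEle oppr_ge0.
by case: (leP 0 (lam 0 k)) => ?; case: (leP (lam 0 k) 0) => ?; nra.
Qed.

(** Complementarity is kept as a matrix equation rather than a zero trace: the later expansions read
    it entry by entry. *)
Lemma moreau X : symS X ->
  [/\ psdS (psd_proj X), psdS (psd_proj X - X) & psd_proj X *m (psd_proj X - X) = 0].
Proof.
move=> Xs; have [P [lam [P1 ->]]] := sym_orthogonal_diag Xs.
rewrite psd_proj_conj// -mulmxBl -mulmxBr -linearB.
split.
- by apply: psd_conj_diag => k; rewrite mxE le_max lexx.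
- by apply: psd_conj_diag => k; rewrite !mxE maxEle; case: (leP 0 (lam 0 k)) => ?; lra.
rewrite !mulmxA -[_ *m P^T *m P]mulmxA P1 mulmx1 -[P *m _ *m _]mulmxA mulmx_diag.
rewrite [X in diag_mx X](_ : _ = 0) ?linear0 ?mulmx0 ?mul0mx//.
apply/rowP => j; rewrite !mxE maxEle; case: leP; rewrite ?mul0r// => _.
by rewrite subrr mulr0.
Qed.

Lemma psd_proj_sym X : symS X -> symS (psd_proj X).
Proof. by case/moreau => -[]. Qed.

Lemma psd_projN X : symS X -> mxdot (psd_proj X) (psd_proj X - X) = 0.
Proof. by case/moreau => -[Ps _] _ h; rewrite /mxdot Ps h mxtrace0. Qed.

Lemma psd_proj_dot X : symS X -> mxdot (psd_proj X) X = mxdot (psd_proj X) (psd_proj X).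
Proof. by move=> /psd_projN; rewrite mxdotBr; lra. Qed.

(** Firm nonexpansiveness [|F|^2 <= <F, X - Y>] follows from the signs of the cross terms
    [<Pi X, Pi Y - Y>] and [<Pi Y, Pi X - X>]; Cauchy-Schwarz concludes. *)
Lemma psd_proj_lip X Y : symS X -> symS Y ->
  mxfnorm (psd_proj X - psd_proj Y) <= mxfnorm (X - Y).
Proof.
move=> Xs Ys.
have [X1 X2 _] := moreau Xs; have [Y1 Y2 _] := moreau Ys.
have h1 := psd_dot_ge0 X1 Y2; have h2 := psd_dot_ge0 Y1 X2.
have h3 := psd_projN Xs; have h4 := psd_projN Ys.
set F := psd_proj X - psd_proj Y.
have h : mxdot F F <= mxdot F (X - Y).
  move: h1 h2 h3 h4; rewrite /F; move: (psd_proj X) (psd_proj Y) => PX PY.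
  rewrite !(mxdotBl, mxdotBr) (mxdotC PY PX).
  move: (mxdot PX X) (mxdot PX Y) (mxdot PY X) (mxdot PY Y) => *; lra.
have := le_trans h (le_trans (ler_norm _) (mxdot_CS _ _)).
rewrite -sqr_mxfnorm expr2; have [->|F0] := eqVneq (mxfnorm F) 0.
  by rewrite mxfnorm_ge0.
by rewrite ler_pM2l// lt0r F0 mxfnorm_ge0.
Qed.

(** The constant dominates the reciprocal of every nonzero eigenvalue, while zero eigenvalues
    contribute to neither side. In this form the spectral gap of [Z] at 0 survives any orthogonal
    change of basis. *)
Lemma psd_inverse_bound Z : psdS Z -> exists2 kappa, 0 < kappa &
  forall v : 'cV[R]_n, mxdot v (Z *m v) <= kappa * mxdot (Z *m v) (Z *m v).
Proof.
move=> Zp; have [P [lam [P1 ZE]]] := sym_orthogonal_diag Zp.1.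
have l0 : forall k, 0 <= lam 0 k by apply: (psd_eigen_ge0 P1); rewrite -ZE.
have s0 : 0 <= \sum_k (lam 0 k)^-1 by apply: sumr_ge0 => k _; rewrite invr_ge0.
exists (1 + \sum_k (lam 0 k)^-1); first by rewrite ltr_pwDl.
move=> v; pose w := P^T *m v.
have Zv : Z *m v = P *m (diag_mx lam *m w) by rewrite ZE -!mulmxA.
rewrite Zv mxdotC mxdot_mull -/w [mxdot (P *m _) _]mxdot_mull mulmxA P1 mul1mx.
rewrite !mxdotE mulr_sumr; apply: ler_sum => k _.
rewrite !big_ord1 mul_diag_mx mxE.
have [->|lk] := eqVneq (lam 0 k) 0; first by rewrite !mul0r mulr0.
have -> : lam 0 k * w k 0 * w k 0 = (lam 0 k)^-1 * (lam 0 k * w k 0 * (lam 0 k * w k 0)).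
  by field.
apply: ler_wpM2r; first by rewrite -expr2 sqr_ge0.
rewrite (bigD1 k)//= addrCA lerDl addr_ge0//.
by apply: sumr_ge0 => i _; rewrite invr_ge0.
Qed.

End Projection.

(** * Second-order expansions of the projection *)

Section Semismooth.
Variables (R : realType) (n : nat).
Implicit Types (X Y Z N D P : 'M[R]_n) (lam : 'rV[R]_n).

Local Notation e_ i := (delta_mx i 0 : 'cV[R]_n).

Lemma mxfnorm_mul_delta X i : mxfnorm (X *m e_ i) <= mxfnorm X.
Proof. by rewrite -colE mxfnorm_col. Qed.

Lemma diag_mul_delta lam i : diag_mx lam *m e_ i = lam 0 i *: e_ i.
Proof.
apply/colP => k; rewrite mul_diag_mx !mxE.
by have [->|] := eqVneq k i; rewrite ?mulr1// !mulr0.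
Qed.

Lemma mxdot_CS_le p q (A B : 'M[R]_(p, q)) a b :
  mxfnorm A <= a -> mxfnorm B <= b -> `|mxdot A B| <= a * b.
Proof.
move=> Aa Bb; apply: le_trans (mxdot_CS _ _) _.
by apply: ler_pM => //; exact: mxfnorm_ge0.
Qed.

Lemma psd_entry_le Z i j a b : psdS Z -> 0 <= a -> 0 <= b ->
  Z i i <= a ^+ 2 -> Z j j <= b ^+ 2 -> `|Z i j| <= a * b.
Proof.
move=> Zp a0 b0 Za Zb; rewrite -(@ler_pXn2r _ 2)// ?nnegrE ?mulr_ge0//.
rewrite real_normK ?num_real// exprMn; apply: le_trans (psd_entry_CS _ _ Zp) _.
by apply: ler_pM => //; exact: psd_diag_ge0.
Qed.

Section EigenBasis.
Variables (Z N D : 'M[R]_n) (lam : 'rV[R]_n) (kappa : R).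
Hypotheses (Zp : psdS Z) (ZN0 : Z *m N = 0) (LE : diag_mx lam = Z - N + D).
Hypotheses (k0 : 0 < kappa)
  (kZ : forall v : 'cV[R]_n, mxdot v (Z *m v) <= kappa * mxdot (Z *m v) (Z *m v)).

Lemma eigenvec_split i : lam 0 i *: e_ i = Z *m e_ i - N *m e_ i + D *m e_ i.
Proof. by rewrite -diag_mul_delta LE mulmxDl mulmxBl. Qed.

(** Pair the eigenvector equation with [Z e_i]; the term in [N] dies because [Z N = 0]. *)
Lemma proj_col_eq i : lam 0 i * Z i i =
  mxdot (Z *m e_ i) (Z *m e_ i) + mxdot (Z *m e_ i) (D *m e_ i).
Proof.
rewrite -mxdot_delta -mxdotZl eigenvec_split mxdotDl mxdotBl.
rewrite (mxdotC (N *m _)) [mxdot (Z *m _) (N *m _)]mxdot_symr; last by case: Zp.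
by rewrite mulmxA ZN0 mul0mx mxdot0r subr0 (mxdotC (D *m _)).
Qed.

(** If [lam_i] lies below the gap of [Z], then [lam_i Z_ii <= c |Z e_i|^2] and the identity above
    becomes [(1 - c) |Z e_i|^2 <= |Z e_i| |D|]. The column is thus first order in [D] and the
    diagonal entry second order. It is used with [c = 0] for eigenvalues of the favourable sign and
    [c = 1/2] for small ones of the other sign. *)
Lemma proj_col_small i (c : R) : 0 <= c < 1 -> lam 0 i * kappa <= c ->
  mxfnorm (Z *m e_ i) <= (1 - c)^-1 * mxfnorm D /\
  Z i i <= kappa * ((1 - c)^-1 * mxfnorm D) ^+ 2.
Proof.
move=> /andP[c0 c1] lc; have c1' : 0 < 1 - c by rewrite subr_gt0.
have kz : Z i i <= kappa * mxfnorm (Z *m e_ i) ^+ 2.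
  by rewrite -mxdot_delta sqr_mxfnorm.
have H : mxfnorm (Z *m e_ i) <= (1 - c)^-1 * mxfnorm D.
  have := proj_col_eq i; rewrite -sqr_mxfnorm.
  have zii : 0 <= Z i i by exact: psd_diag_ge0.
  have z0 := mxfnorm_ge0 (Z *m e_ i).
  have := mxdot_CS_le (lexx (mxfnorm (Z *m e_ i))) (mxfnorm_mul_delta D i).
  have := ler_norm (- mxdot (Z *m e_ i) (D *m e_ i)); rewrite normrN.
  have d0 := mxfnorm_ge0 D.
  move: (mxdot _ _) kz zii z0 d0 => t; move: (mxfnorm (Z *m _)) (mxfnorm D) (Z i i) => z d w.
  move=> kz w0 z0 d0 h1 h2 h3; rewrite mulrC ler_pdivlMr//.
  have : (1 - c) * z ^+ 2 <= z * d.
    have : lam 0 i * w <= c * z ^+ 2; last by lra.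
    have [l0|l0] := leP (lam 0 i) 0; first by have := sqr_ge0 z; nra.
    apply: le_trans (ler_wpM2l (ltW l0) kz) _; rewrite mulrA.
    by apply: ler_wpM2r => //; exact: sqr_ge0.
  have [->|zn0] := eqVneq z 0; last first.
    have zp : 0 < z by rewrite lt0r zn0.
    by rewrite expr2 mulrCA ler_pM2l// mulrC.
  by rewrite !mul0r.
split=> //; apply: le_trans kz _; apply: ler_wpM2l; first exact: ltW.
by rewrite ler_pXn2r// nnegrE ?mxfnorm_ge0// (le_trans (mxfnorm_ge0 _) H).
Qed.

End EigenBasis.

Section EigenBasisPair.
Variables (Z N D : 'M[R]_n) (lam : 'rV[R]_n) (kappa : R).
Hypotheses (Zp : psdS Z) (Np : psdS N) (Ds : symS D) (ZN0 : Z *m N = 0).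
Hypotheses (LE : diag_mx lam = Z - N + D) (k0 : 0 < kappa).
Hypothesis kZ : forall v : 'cV[R]_n, mxdot v (Z *m v) <= kappa * mxdot (Z *m v) (Z *m v).
Hypothesis kN : forall v : 'cV[R]_n, mxdot v (N *m v) <= kappa * mxdot (N *m v) (N *m v).

Let d := mxfnorm D.

Let d0 : 0 <= d. Proof. exact: mxfnorm_ge0. Qed.

Let NZ0 : N *m Z = 0.
Proof.
by rewrite -Zp.1 -Np.1 -trmx_mul ZN0 trmx0.
Qed.

Let NE : diag_mx (- lam) = N - Z + (- D).
Proof. by rewrite linearN /= LE opprD opprB addrC. Qed.

Let Z_small i (c : R) (h : 0 <= c < 1) (h' : lam 0 i * kappa <= c) :=
  proj_col_small Zp ZN0 LE k0 kZ h h'.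

(** The configuration is invariant under exchanging [Z] with [N] and changing the signs of [D] and
    [lam]. *)
Let N_small i (c : R) (h : 0 <= c < 1) :
  - lam 0 i * kappa <= c ->
  mxfnorm (N *m e_ i) <= (1 - c)^-1 * d /\ N i i <= kappa * ((1 - c)^-1 * d) ^+ 2.
Proof.
move=> h'; have := @proj_col_small N Z (- D) (- lam) kappa Np NZ0 NE k0 kN i c h.
by rewrite mxE mxfnormN; apply.
Qed.

Let sk := Num.sqrt kappa.
Let sk0 : 0 <= sk. Proof. exact: sqrtr_ge0. Qed.
Let sk2 : sk ^+ 2 = kappa. Proof. by rewrite sqr_sqrtr// ltW. Qed.

(** The diagonal entries of [N] are second order here, and the psd inequality [N_ij^2 <= N_ii N_jj]
    passes this on to the whole block. *)
Lemma posblock_small i j : 0 < lam 0 i -> 0 < lam 0 j -> `|N i j| <= kappa * d ^+ 2.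
Proof.
have H k : 0 < lam 0 k -> N k k <= (sk * d) ^+ 2.
  move=> lk; have [||_] := @N_small k 0; first by rewrite lexx ltr01.
    by rewrite mulNr oppr_le0 mulr_ge0// ltW.
  by rewrite subr0 invr1 mul1r exprMn sk2.
move=> li lj; have sd0 := mulr_ge0 sk0 d0.
have := psd_entry_le Np sd0 sd0 (H i li) (H j lj).
by rewrite -expr2 exprMn sk2.
Qed.

Lemma negblock_small i j : lam 0 i <= 0 -> lam 0 j <= 0 -> `|Z i j| <= kappa * d ^+ 2.
Proof.
have H k : lam 0 k <= 0 -> Z k k <= (sk * d) ^+ 2.
  move=> lk; have [||_] := @Z_small k 0; first by rewrite lexx ltr01.
    by rewrite pmulr_lle0.
  by rewrite subr0 invr1 mul1r exprMn sk2.
move=> li lj; have sd0 := mulr_ge0 sk0 d0.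
have := psd_entry_le Zp sd0 sd0 (H i li) (H j lj).
by rewrite -expr2 exprMn sk2.
Qed.

Let half01 : 0 <= (2^-1 : R) < 1.
Proof. by rewrite invr_ge0 ler0n/= invf_lt1 ?ltr1n. Qed.

Let halfE : (1 - 2^-1 : R)^-1 = 2.
Proof. by field. Qed.

(** Both eigenvalues are within [1 / (2 kappa)] of 0, so both are below the gaps of [Z] and of [N],
    and all four diagonal entries are second order; the factor 2 is [1 / (1 - c)] at [c = 1/2]. *)
Lemma crossblock_near i j : 0 < lam 0 i -> lam 0 j <= 0 ->
  (lam 0 i - lam 0 j) * kappa <= 2^-1 ->
  `|Z i j| <= 2 * kappa * d ^+ 2 /\ `|N i j| <= 2 * kappa * d ^+ 2.
Proof.
move=> li lj lij.
have li2 : lam 0 i * kappa <= 2^-1 by nra.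
have lj2 : - lam 0 j * kappa <= 2^-1 by nra.
have sd0 := mulr_ge0 sk0 d0; have sd20 : 0 <= 2 * (sk * d) by rewrite mulr_ge0.
have z00 : 0 <= (0 : R) < 1 by rewrite lexx ltr01.
have [_ Zi] := Z_small half01 li2; have [_ Nj] := N_small half01 lj2.
have [|_ Zj] := @Z_small j 0 z00; first by rewrite pmulr_lle0.
have [|_ Ni] := @N_small i 0 z00; first by rewrite mulNr oppr_le0 mulr_ge0// ltW.
move: Zi Nj Zj Ni; rewrite halfE subr0 invr1 mul1r -sk2 -!exprMn [sk * (2 * _)]mulrCA.
move=> Zi Nj Zj Ni; have -> : 2 * sk ^+ 2 * d ^+ 2 = 2 * (sk * d) * (sk * d) by ring.
split; first exact: psd_entry_le.
by rewrite [leRHS]mulrC; apply: psd_entry_le.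
Qed.

(* Pairing [lam_i e_i = Z e_i - N e_i + D e_i] with [N e_j], and the same for [j]
   with [N e_i] and [D e_i], cancels all the first-order terms. *)
Lemma crossblock_numerator i j : 0 < lam 0 i -> lam 0 j <= 0 ->
  `|lam 0 j * Z i j - lam 0 i * N i j| <= 3 * d ^+ 2.
Proof.
move=> li lj; have z00 : 0 <= (0 : R) < 1 by rewrite lexx ltr01.
have [|Zj _] := @Z_small j 0 z00; first by rewrite pmulr_lle0.
have [|Ni _] := @N_small i 0 z00; first by rewrite mulNr oppr_le0 mulr_ge0// ltW.
move: Zj Ni; rewrite subr0 invr1 mul1r -/d => Zj Ni.
have Di k : mxfnorm (D *m e_ k) <= d := mxfnorm_mul_delta D k.
have [Zs Ns] : symS Z /\ symS N by split; [exact: Zp.1|exact: Np.1].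
have ZN (u v : 'cV[R]_n) : mxdot (Z *m u) (N *m v) = 0.
  by rewrite mxdot_symr// mulmxA ZN0 mul0mx mxdot0r.
have NZ (u v : 'cV[R]_n) : mxdot (N *m u) (Z *m v) = 0 by rewrite mxdotC ZN.
have E1 : lam 0 i * N i j = - mxdot (N *m e_ i) (N *m e_ j) + mxdot (D *m e_ i) (N *m e_ j).
  by rewrite -mxdot_delta -mxdotZl (eigenvec_split LE) mxdotDl mxdotBl ZN sub0r.
have E2 : lam 0 j * N i j = - mxdot (N *m e_ i) (N *m e_ j) + mxdot (N *m e_ i) (D *m e_ j).
  by rewrite -mxdot_delta -mxdot_symr// -mxdotZr (eigenvec_split LE) mxdotDr mxdotBr NZ sub0r.
have E3 : lam 0 j * D i j = mxdot (D *m e_ i) (Z *m e_ j) - mxdot (D *m e_ i) (N *m e_ j)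
    + mxdot (D *m e_ i) (D *m e_ j).
  by rewrite -mxdot_delta -mxdot_symr// -mxdotZr (eigenvec_split LE) mxdotDr mxdotBr.
have E4 : lam 0 j * (Z i j - N i j + D i j) = 0.
  have -> : Z i j - N i j + D i j = diag_mx lam i j by rewrite LE !mxE.
  rewrite mxE; have [ij|] := eqVneq i j; last by rewrite mulr0n mulr0.
  by move: li; rewrite ij; lra.
have -> : lam 0 j * Z i j - lam 0 i * N i j =
    mxdot (N *m e_ i) (D *m e_ j) - mxdot (D *m e_ i) (Z *m e_ j)
    - mxdot (D *m e_ i) (D *m e_ j) by lra.
have h1 := mxdot_CS_le Ni (Di j); have h2 := mxdot_CS_le (Di i) Zj.
have h3 := mxdot_CS_le (Di i) (Di j).
apply: le_trans (ler_normB _ _) _; apply: le_trans (lerD (ler_normB _ _) (lexx _)) _.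
by move: h1 h2 h3; rewrite -expr2; lra.
Qed.

(** The denominator [lam_i - lam_j] has no lower bound. If it exceeds [1 / (2 kappa)], the
    second-order numerator suffices; otherwise [Z_ij] and [N_ij] are themselves second order and
    their weights are at most 1. *)
Lemma crossblock_small i j : 0 < lam 0 i -> lam 0 j <= 0 ->
  `|lam 0 i / (lam 0 i - lam 0 j) * (Z - N) i j - Z i j| <= 6 * kappa * d ^+ 2.
Proof.
move=> li lj; have lij : 0 < lam 0 i - lam 0 j by lra.
have -> : lam 0 i / (lam 0 i - lam 0 j) * (Z - N) i j - Z i j =
    (lam 0 j * Z i j - lam 0 i * N i j) / (lam 0 i - lam 0 j).
  by rewrite !mxE; field; rewrite gt_eqF.
rewrite normrM normfV (gtr0_norm lij) ler_pdivrMr//.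
have [near|far] := leP ((lam 0 i - lam 0 j) * kappa) 2^-1; last first.
  apply: le_trans (crossblock_numerator li lj) _.
  by have := sqr_ge0 d; nra.
have [Zij Nij] := crossblock_near li lj near.
apply: le_trans (ler_normB _ _) _; rewrite !normrM (gtr0_norm li) (ler0_norm lj).
have kd : 0 <= kappa * d ^+ 2 by rewrite mulr_ge0 ?sqr_ge0// ltW.
nra.
Qed.

Lemma semismooth_entry i j :
  `|Sigma_mx lam i j * (Z - N) i j - Z i j| <= 6 * kappa * d ^+ 2.
Proof.
have kd : 0 <= kappa * d ^+ 2 by rewrite mulr_ge0 ?sqr_ge0// ltW.
have ZNs : symS (Z - N) by apply: symSB; [exact: Zp.1|exact: Np.1].
rewrite mxE; case: ltP => li; case: ltP => lj.
- rewrite !mxE mul1r addrAC subrr add0r normrN.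
  by have := posblock_small li lj; lra.
- exact: crossblock_small.
- by rewrite (symSE i j ZNs) (symSE i j Zp.1); exact: crossblock_small.
- by rewrite mul0r sub0r normrN; have := negblock_small li lj; lra.
Qed.

End EigenBasisPair.

Lemma U_op_conj P lam X :
  P^T *m P = 1%:M ->
  P^T *m U_op P lam X *m P = map2_mx *%R (Sigma_mx lam) (P^T *m X *m P).
Proof. by move=> P1; rewrite conjK. Qed.

(** The identity [U_Y Y = Pi(Y)] reduces the remainder [Pi(Y) - Pi(X) - U_Y(Y - X)] to
    [U_Y X - Pi(X)], which is compared entrywise in an eigenbasis of [Y]. *)
Lemma U_op_self P lam : P^T *m P = 1%:M ->
  U_op P lam (P *m diag_mx lam *m P^T) = psd_proj (P *m diag_mx lam *m P^T).
Proof.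
move=> P1; rewrite psd_proj_conj// /U_op conjK//; congr (_ *m _ *m _).
apply/matrixP => i j; rewrite !mxE; have [->|ij] := eqVneq i j; last by rewrite !mulr0n mulr0.
rewrite !mulr1n maxEle; case: ltP => [l0|l0]; first by rewrite mul1r ltW.
by rewrite mul0r; case: leP => // l1; apply/eqP; rewrite eq_le l0 l1.
Qed.

Lemma U_opB P lam X Y : U_op P lam (X - Y) = U_op P lam X - U_op P lam Y.
Proof.
rewrite /U_op -mulmxBl -mulmxBr [P^T *m (X - Y)]mulmxBr [(_ - _) *m P]mulmxBl; congr (_ *m _ *m _).
by apply/matrixP => i j; rewrite !mxE mulrBr.
Qed.

Lemma psd_proj_semismooth X : symS X -> exists2 K, 0 <= K &
  forall Y P lam, P^T *m P = 1%:M -> Y = P *m diag_mx lam *m P^T ->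
    mxfnorm (psd_proj Y - psd_proj X - U_op P lam (Y - X)) <= K * mxfnorm (Y - X) ^+ 2.
Proof.
move=> Xs; have [Zp Np ZN] := moreau Xs.
have [k1 k10 kZ] := psd_inverse_bound Zp; have [k2 k20 kN] := psd_inverse_bound Np.
set Z := psd_proj X in Zp Np ZN kZ *; pose N := Z - X.
exists ((n * n)%:R * (6 * (k1 + k2))).
  by rewrite mulr_ge0// mulr_ge0// addr_ge0// ltW.
move=> Y P lam P1 YE; have PP := orthoC P1.
rewrite U_opB {1 2}YE -U_op_self// -YE.
have -> : U_op P lam Y - Z - (U_op P lam Y - U_op P lam X) = U_op P lam X - Z.
  by rewrite opprB addrC addrA subrK.
rewrite -(mxfnorm_conjT _ P1) mulmxBr mulmxBl U_op_conj//.
pose D := P^T *m (Y - X) *m P.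
rewrite -(mxfnorm_conjT (Y - X) P1) -/D.
rewrite -mulrA -mulrA; apply: mxfnorm_le_max => i j.
have Ds : symS D.
  apply: symS_congr; apply: symSB => //.
  by rewrite YE -{1}[P]trmxK; apply: symS_congr; rewrite /symS /= tr_diag_mx.
have LE : diag_mx lam = P^T *m Z *m P - P^T *m N *m P + D.
  by rewrite /D /N -!mulmxBl -!mulmxBr -mulmxDl -mulmxDr subKr addrC subrK YE conjK.
have ZN0 : P^T *m Z *m P *m (P^T *m N *m P) = 0.
  by rewrite !mulmxA -[_ *m P *m P^T]mulmxA PP mulmx1 -[P^T *m Z *m _]mulmxA ZN mulmx0 mul0mx.
have kC M : (forall v : 'cV[R]_n, mxdot v (M *m v) <= (k1 + k2) * mxdot (M *m v) (M *m v)) ->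
  forall v : 'cV[R]_n, mxdot v (P^T *m M *m P *m v) <=
    (k1 + k2) * mxdot (P^T *m M *m P *m v) (P^T *m M *m P *m v).
  move=> h v; have := h (P *m v).
  rewrite -!mulmxA -mxdot_mull; set A := M *m (P *m v).
  by rewrite [mxdot (P^T *m A) _]mxdot_mull trmxK (mulmxA P) PP mul1mx.
have := @semismooth_entry (P^T *m Z *m P) (P^T *m N *m P) D lam (k1 + k2)
   (psd_congr P Zp) (psd_congr P Np) Ds ZN0 LE (addr_gt0 k10 k20) _ _ i j.
rewrite -mulmxBl -mulmxBr /N subKr mulrA.
move=> H; have {H} := H (kC _ _) (kC _ _); rewrite !mxE; apply.
- by move=> v; apply: le_trans (kZ v) _; rewrite ler_wpM2r ?mxdot_ge0// lerDl ltW.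
- by move=> v; apply: le_trans (kN v) _; rewrite ler_wpM2r ?mxdot_ge0// lerDr ltW.
Qed.

(** An entry [k = - m / z] facing a nonzero eigenvalue is second order, so its product with the
    first-order entry [f] is third order. *)
Lemma trapezoid_entry (z k f m ka : R) d : 0 < z -> z^-1 <= ka -> 0 <= d ->
  z * k + m = 0 -> `|m| <= 2 * d ^+ 2 -> `|f| <= 2 * d -> `|f * k| <= 4 * ka * d ^+ 3.
Proof.
move=> z0 zk d0 E m2 fd.
have kE : k = - m / z by rewrite (_ : m = - (z * k)); [field; rewrite gt_eqF|lra].
have ka0 : 0 <= ka by apply: le_trans zk; rewrite invr_ge0 ltW.
have kd : `|k| <= 2 * d ^+ 2 * ka.
  by rewrite kE normrM normrN normfV (gtr0_norm z0); apply: ler_pM; rewrite ?invr_ge0// ltW.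
rewrite normrM; have -> : 4 * ka * d ^+ 3 = 2 * d * (2 * d ^+ 2 * ka) by ring.
exact: ler_pM.
Qed.

(* [s] is the sign vector of the eigenvalues of X: symmetrising the sum in (i, j) gives
   the weights (s i + s j) / 2, which vanish on the pairs of opposite signs. *)
Lemma trapezoid_sum (s : 'I_n -> R) (M F K : 'M[R]_n) (ka d : R) :
  M = F *m K -> symS F -> symS K ->
  (forall i, s i = 0 \/ s i = 1 \/ s i = -1) ->
  (forall i j, s i = 1 -> s j = 1 \/ s j = 0 -> `|F i j * K i j| <= 4 * ka * d ^+ 3) ->
  (forall i j, s i = -1 -> s j = -1 \/ s j = 0 -> `|F i j * K i j| <= 4 * ka * d ^+ 3) ->
  0 <= 4 * ka * d ^+ 3 ->
  `|\sum_i s i * M i i| <= (n * n)%:R * (4 * ka * d ^+ 3).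
Proof.
move=> ME Fs Ks s3 H1 H2 c0; set c := 4 * ka * d ^+ 3 in H1 H2 c0 *.
have E1 : \sum_i s i * M i i = \sum_i \sum_j s i * (F i j * K i j).
  apply: eq_bigr => i _; rewrite ME mxE mulr_sumr; apply: eq_bigr => j _.
  by rewrite (symSE j i Ks).
have E2 : \sum_i s i * M i i = \sum_i \sum_j s j * (F i j * K i j).
  rewrite E1 exchange_big; apply: eq_bigr => i _; apply: eq_bigr => j _.
  by rewrite (symSE j i Ks) (symSE j i Fs).
have -> : \sum_i s i * M i i = \sum_i \sum_j ((s i + s j) / 2 * (F i j * K i j)).
  have E3 : \sum_i s i * M i i = 2^-1 * (\sum_i s i * M i i + \sum_i s i * M i i) by field.
  rewrite E3 {1}E1 E2 -big_split mulr_sumr; apply: eq_bigr => i _ /=.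
  by rewrite -big_split mulr_sumr; apply: eq_bigr => j _ /=; field.
apply: (@le_trans _ _ (\sum_(i < n) \sum_(j < n) c)); last first.
  by rewrite !sumr_const !card_ord -mulrnA mulr_natl.
apply: le_trans (ler_norm_sum _ _ _) _; apply: ler_sum => i _.
apply: le_trans (ler_norm_sum _ _ _) _; apply: ler_sum => j _.
rewrite normrM.
have FK0 := normr_ge0 (F i j * K i j).
have sFK : `|F j i * K j i| = `|F i j * K i j| by rewrite (symSE j i Ks) (symSE j i Fs).
have mul_le t a : 0 <= a -> a <= c -> -1 <= t -> t <= 1 -> `|t| * a <= c.
  move=> a0 ac t1 t2; have t3 : `|t| <= 1 by rewrite ler_norml t1.
  by apply: le_trans ac; rewrite ler_piMl.
have mul_0 t a : t = 0 -> `|t| * a <= c by move=> ->; rewrite normr0 mul0r.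
have h1 := H1 i j; have h1' := H1 j i; have h2 := H2 i j; have h2' := H2 j i.
rewrite !sFK in h1' h2'.
clear E1 E2 H1 H2 ME sFK; move: `|F i j * K i j| FK0 h1 h1' h2 h2'.
move=> a a0 h1 h1' h2 h2'.
case: (s3 i) => [si|[si|si]]; case: (s3 j) => [sj|[sj|sj]]; rewrite si sj in h1 h1' h2 h2' *;
  first [by apply: mul_0; lra | apply: mul_le => //; try lra; auto].
Qed.

(** In the eigenbasis of [X], let [F] and [K] be the increments of [Pi] and of [Pi - id]. Expanding
    [Pi(Y) (Pi(Y) - Y) = 0] gives [z_i K_ij + F_ij w_j + (F K)_ij = 0], whose diagonal turns the
    difference into [- sum_i sg(lam_i) (F K)_ii]. A priori this is only second order; the
    symmetrisation in [trapezoid_sum] gains one order. *)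
Lemma psd_proj_trapezoid X : symS X -> exists2 K, 0 <= K &
  forall Y, symS Y ->
    `|mxdot (psd_proj Y) X - mxdot (psd_proj X) Y| <= K * mxfnorm (Y - X) ^+ 3.
Proof.
move=> Xs; have [P [lam [P1 XE]]] := sym_orthogonal_diag Xs.
pose ka := \sum_k `|lam 0 k|^-1.
have ka0 : 0 <= ka by apply: sumr_ge0 => k _; rewrite invr_ge0.
exists ((n * n)%:R * (4 * ka)); first by rewrite !mulr_ge0.
move=> Y Ys; set d := mxfnorm (Y - X).
have d0 : 0 <= d := mxfnorm_ge0 _.
pose z := map_mx (Num.max 0) lam; pose w := z - lam.
pose F := P^T *m (psd_proj Y - psd_proj X) *m P.
pose K := P^T *m ((psd_proj Y - Y) - (psd_proj X - X)) *m P.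
have ZE : psd_proj X = P *m diag_mx z *m P^T by rewrite XE psd_proj_conj.
have NE : psd_proj X - X = P *m diag_mx w *m P^T.
  by rewrite ZE {1}XE -mulmxBl -mulmxBr -linearB.
have Fs : symS F by apply: symS_congr; apply: symSB; exact: psd_proj_sym.
have Ks : symS K.
  by apply: symS_congr; apply: symSB; apply: symSB => //; exact: psd_proj_sym.
have Fd : mxfnorm F <= d.
  by rewrite mxfnorm_conjT//; exact: psd_proj_lip.
have Kd : mxfnorm K <= 2 * d.
  rewrite mxfnorm_conjT//.
  have -> : psd_proj Y - Y - (psd_proj X - X) = (psd_proj Y - psd_proj X) - (Y - X).
    by apply/matrixP => i j; rewrite !mxE; ring.
  apply: le_trans (mxfnormB _ _) _.
  by have := psd_proj_lip Ys Xs; rewrite -/d; lra.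
have [_ _ ZNY] := moreau Ys; have [_ _ ZNX] := moreau Xs.
have zw : diag_mx z *m diag_mx w = 0.
  rewrite -(conjK (diag_mx z) P1) -(conjK (diag_mx w) P1) -ZE -NE.
  by rewrite -!mulmxA (mulmxA P) orthoC// mul1mx (mulmxA (psd_proj X)) ZNX mul0mx mulmx0.
have ZY : P^T *m psd_proj Y *m P = diag_mx z + F.
  by rewrite -(conjK (diag_mx z) P1) -ZE -mulmxDl -mulmxDr subrKC.
have NY : P^T *m (psd_proj Y - Y) *m P = diag_mx w + K.
  by rewrite -(conjK (diag_mx w) P1) -NE -mulmxDl -mulmxDr subrKC.
have E i j : z 0 i * K i j + F i j * w 0 j + (F *m K) i j = 0.
  have : (diag_mx z + F) *m (diag_mx w + K) = 0.
    rewrite -ZY -NY -!mulmxA (mulmxA P) orthoC// mul1mx (mulmxA (psd_proj Y)) ZNY.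
    by rewrite mul0mx mulmx0.
  rewrite mulmxDl !mulmxDr zw add0r mul_diag_mx mul_mx_diag.
  by move=> /matrixP /(_ i j); rewrite ![in X in X -> _]mxE => <-; rewrite !mxE; ring.
have -> : mxdot (psd_proj Y) X - mxdot (psd_proj X) Y =
    - \sum_i Num.sg (lam 0 i) * (F *m K) i i.
  have -> : mxdot (psd_proj Y) X - mxdot (psd_proj X) Y =
     mxdot (psd_proj X) ((psd_proj Y - Y) - (psd_proj X - X))
     - mxdot (psd_proj X - X) (psd_proj Y - psd_proj X).
    have := psd_projN Xs; move: (psd_proj X) (psd_proj Y) => PX PY.
    rewrite !(mxdotBl, mxdotBr) (mxdotC X PY) (mxdotC X PX).
    by move: (mxdot PX X) (mxdot PX PX) (mxdot PX Y) (mxdot PY X) (mxdot PX PY) => *; lra.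
  rewrite {1}ZE {2}NE !mxdot_conj -/F -/K !mxdot_diag -sumrB -sumrN.
  apply: eq_bigr => i _; have := E i i; rewrite !mxE maxEle.
  have [l0|l0|<-] := ltgtP 0 (lam 0 i).
  - by rewrite gtr0_sg//; lra.
  - by rewrite ltr0_sg//; lra.
  - by rewrite sgr0; lra.
have M2 i j : `|(F *m K) i j| <= 2 * d ^+ 2.
  apply: le_trans (mxentry_le_fnorm _ _ _) _; apply: le_trans (mxfnormM _ _) _.
  by rewrite expr2 mulrCA; apply: ler_pM => //; exact: mxfnorm_ge0.
have kaE i : `|lam 0 i|^-1 <= ka.
  by rewrite /ka (bigD1 i)//= lerDl; apply: sumr_ge0 => k _; rewrite invr_ge0.
rewrite normrN -mulrA; apply: (@trapezoid_sum _ _ F K) => //.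
- by move=> i; case: sgrP; auto.
- move=> i j si sj; have li : 0 < lam 0 i by rewrite -sgr_gt0 si.
  have lj : 0 <= lam 0 j by rewrite -sgr_ge0; case: sj => ->.
  have zi : z 0 i = lam 0 i by rewrite mxE maxEle ltW.
  have wj : w 0 j = 0 by rewrite !mxE maxEle lj subrr.
  apply: (@trapezoid_entry (lam 0 i) _ _ ((F *m K) i j)) => //.
  + by have := kaE i; rewrite gtr0_norm.
  + by have := E i j; rewrite zi wj mulr0 addr0.
  + by apply: le_trans (mxentry_le_fnorm _ _ _) _; lra.
- move=> i j si sj; have li : lam 0 i < 0 by rewrite -sgr_lt0 si ltrN10.
  have lj : lam 0 j <= 0 by rewrite -sgr_le0; case: sj => ->; rewrite ?lerN10.
  have zj : z 0 j = 0 by rewrite mxE; apply/max_idPl.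
  have wi : w 0 i = - lam 0 i by rewrite !mxE (max_idPl (ltW li)) sub0r.
  rewrite (symSE i j Fs) (symSE i j Ks) mulrC.
  apply: (@trapezoid_entry (- lam 0 i) _ _ ((F *m K) j i)) => //.
  + by rewrite oppr_gt0.
  + by have := kaE i; rewrite ltr0_norm.
  + by have := E j i; rewrite zj wi mul0r add0r mulrC.
  + by apply: le_trans (mxentry_le_fnorm _ _ _) _.
- by rewrite !mulr_ge0// exprn_ge0.
Qed.

End Semismooth.

(** * Euclidean structure of the product space and its comparison with the ambient norm *)

Section ProductInnerProduct.
Variables (R : realType) (m n : nat).
Local Notation E := ('M[R]_n * 'cV[R]_m)%type.
Implicit Types u v w : E.

Lemma pdotC u v : pdot u v = pdot v u.
Proof. by rewrite /pdot mxdotC [X in _ + X]mxdotC. Qed.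

Lemma pdotDl u v w : pdot (u + v) w = pdot u w + pdot v w.
Proof. by rewrite /pdot !mxdotDl addrACA. Qed.

Lemma pdotZl a u w : pdot (a *: u) w = a * pdot u w.
Proof. by rewrite /pdot !mxdotZl mulrDr. Qed.

Lemma pdotDr u v w : pdot w (u + v) = pdot w u + pdot w v.
Proof. by rewrite !(pdotC w) pdotDl. Qed.

Lemma pdotZr a u w : pdot w (a *: u) = a * pdot w u.
Proof. by rewrite !(pdotC w) pdotZl. Qed.

Lemma pdotNl u v : pdot (- u) v = - pdot u v.
Proof. by rewrite -scaleN1r pdotZl mulN1r. Qed.

Lemma pdotNr u v : pdot u (- v) = - pdot u v.
Proof. by rewrite !(pdotC u) pdotNl. Qed.

Lemma pdotBl u v w : pdot (u - v) w = pdot u w - pdot v w.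
Proof. by rewrite pdotDl pdotNl. Qed.

Lemma pdotBr u v w : pdot w (u - v) = pdot w u - pdot w v.
Proof. by rewrite pdotDr pdotNr. Qed.

Lemma pdot0r u : pdot u 0 = 0.
Proof. by rewrite -(scale0r 0) pdotZr mul0r. Qed.

Lemma pdot_ge0 u : 0 <= pdot u u.
Proof. by rewrite addr_ge0// mxdot_ge0. Qed.

Lemma sqr_pnorm u : pnorm u ^+ 2 = pdot u u.
Proof. by rewrite sqr_sqrtr// pdot_ge0. Qed.

Lemma pnorm_ge0 u : 0 <= pnorm u.
Proof. exact: sqrtr_ge0. Qed.

Lemma pdot_CS u v : `|pdot u v| <= pnorm u * pnorm v.
Proof. exact: (semidot_normCS pdotC pdotDl pdotZl pdot_ge0). Qed.

Lemma pdot_le u v : pdot u v <= pnorm u * pnorm v.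
Proof. exact: le_trans (ler_norm _) (pdot_CS _ _). Qed.

Lemma pnormD u v : pnorm (u + v) <= pnorm u + pnorm v.
Proof. exact: (seminrmD pdotC pdotDl pdotZl pdot_ge0). Qed.

Lemma pnormZ a u : pnorm (a *: u) = `|a| * pnorm u.
Proof. exact: (seminrmZ pdotC pdotZl). Qed.

Lemma pnormN u : pnorm (- u) = pnorm u.
Proof. by rewrite -scaleN1r pnormZ normrN1 mul1r. Qed.

Lemma pnormB u v : pnorm (u - v) <= pnorm u + pnorm v.
Proof. by rewrite (le_trans (pnormD _ _))// pnormN. Qed.

Lemma pnorm_distC u v : pnorm (u - v) = pnorm (v - u).
Proof. by rewrite -pnormN opprB. Qed.

Lemma pnorm0 : pnorm (0 : E) = 0.
Proof. by rewrite /pnorm pdot0r sqrtr0. Qed.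

Lemma mxfnorm_fst u : mxfnorm u.1 <= pnorm u.
Proof. by apply: ler_wsqrtr; rewrite lerDl mxdot_ge0. Qed.

Lemma mxfnorm_snd u : mxfnorm u.2 <= pnorm u.
Proof. by apply: ler_wsqrtr; rewrite lerDr mxdot_ge0. Qed.

Lemma pnorm_le_sum u : pnorm u <= mxfnorm u.1 + mxfnorm u.2.
Proof.
rewrite -(@ler_pXn2r _ 2)// ?nnegrE ?addr_ge0 ?pnorm_ge0 ?mxfnorm_ge0//.
rewrite sqrrD sqr_pnorm !sqr_mxfnorm /pdot.
by have := mulr_ge0 (mxfnorm_ge0 u.1) (mxfnorm_ge0 u.2); lra.
Qed.

Lemma pnorm_eq0 u : pnorm u = 0 -> u = 0.
Proof.
move=> u0; case: u u0 => u1 u2 u0.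
have := mxfnorm_fst (u1, u2); have := mxfnorm_snd (u1, u2); rewrite u0 /= => h1 h2.
congr (_, _); apply: mxfnorm_eq0; apply/eqP; rewrite eq_le mxfnorm_ge0 ?h1 ?h2//.
Qed.

Lemma mxfnorm_le_norm p q (X : 'M[R]_(p, q)) : mxfnorm X <= (p * q)%:R * `|X|.
Proof.
apply: mxfnorm_le_max => i j; rewrite [leRHS]/Num.Def.normr/= mx_normrE.
exact: (le_bigmax _ (fun ij : 'I_p * 'I_q => `|X ij.1 ij.2|) (i, j)).
Qed.

Lemma norm_le_mxfnorm p q (X : 'M[R]_(p, q)) : `|X| <= mxfnorm X.
Proof.
rewrite [leLHS]/Num.Def.normr/= mx_normrE.
by apply: bigmax_le; [exact: mxfnorm_ge0|move=> ij _; exact: mxentry_le_fnorm].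
Qed.

Lemma pnorm_le_norm u : pnorm u <= (n * n + m)%:R * `|u|.
Proof.
apply: le_trans (pnorm_le_sum _) _; rewrite natrD mulrDl; apply: lerD.
  apply: le_trans (mxfnorm_le_norm _) _; apply: ler_wpM2l => //.
  by rewrite prod_normE le_max lexx.
apply: le_trans (mxfnorm_le_norm _) _; rewrite muln1; apply: ler_wpM2l => //.
by rewrite prod_normE le_max lexx orbT.
Qed.

Lemma norm_le_pnorm u : `|u| <= pnorm u.
Proof.
rewrite prod_normE ge_max (le_trans (norm_le_mxfnorm _) (mxfnorm_fst _))/=.
exact: le_trans (norm_le_mxfnorm _) (mxfnorm_snd _).
Qed.

Lemma near_pnorm_le (p : E) (e : R) : 0 < e -> \forall u \near p, pnorm (u - p) <= e.
Proof.
move=> e0; have c0 : 0 < (n * n + m)%:R + 1 :> R by rewrite ltr_wpDl.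
apply/nbhs_normP; exists (e / ((n * n + m)%:R + 1)) => /=; first by rewrite divr_gt0.
move=> u; rewrite /ball_ /= distrC ltr_pdivlMr// => he.
apply: le_trans (pnorm_le_norm _) _; apply: le_trans (ltW he).
by rewrite mulrC ler_wpM2l// lerDl.
Qed.

Lemma near0_ex_scale (P : set E) u : (\forall h \near (0 : E), P h) ->
  exists2 t : R, 0 < t & P (t *: u).
Proof.
move=> /nbhs_normP[d /= d0 dP].
have c0 : 0 < `|u| + 1 by rewrite ltr_wpDl.
exists (d / (`|u| + 1) / 2); first by rewrite !divr_gt0.
apply: dP; rewrite /ball_ /= sub0r normrN normrZ gtr0_norm ?divr_gt0//.
have -> : d / (`|u| + 1) / 2 * `|u| = d * (`|u| / (2 * (`|u| + 1))).
  by field; rewrite gt_eqF.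
rewrite gtr_pMr// ltr_pdivrMr ?mulr_gt0//.
by have := normr_ge0 u; lra.
Qed.

End ProductInnerProduct.

(** * The function [theta = |Pi|^2 / 2], whose gradient is [Pi] *)

Section HalfSquaredProjection.
Variables (R : realType) (n : nat).
Implicit Types (X Y Z N P H : 'M[R]_n) (lam : 'rV[R]_n).

(** Convexity of [theta]: combine [<Pi X, Pi Y - Y> >= 0] with [|Pi X - Pi Y|^2 >= 0]. *)
Lemma theta_lower X Y : symS X -> symS Y ->
  mxfnorm (psd_proj X) ^+ 2 / 2 + mxdot (psd_proj X) (Y - X) <= mxfnorm (psd_proj Y) ^+ 2 / 2.
Proof.
move=> Xs Ys; rewrite !sqr_mxfnorm mxdotBr (psd_proj_dot Xs).
have [Xp _ _] := moreau Xs; have [_ Yn _] := moreau Ys.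
have := psd_dot_ge0 Xp Yn; have := mxdot_ge0 (psd_proj X - psd_proj Y).
move: (psd_proj X) (psd_proj Y) {Xp Yn} => PX PY.
rewrite mxdotBl !mxdotBr (mxdotC PY PX); move: (mxdot PX PX) (mxdot PY PY) (mxdot PX PY) => *; lra.
Qed.

(** The convexity inequality taken at [Y], after which nonexpansiveness replaces [Pi Y] by
    [Pi X]. *)
Lemma theta_upper X Y : symS X -> symS Y ->
  mxfnorm (psd_proj Y) ^+ 2 / 2 <=
  mxfnorm (psd_proj X) ^+ 2 / 2 + mxdot (psd_proj X) (Y - X) + mxfnorm (Y - X) ^+ 2.
Proof.
move=> Xs Ys; have := theta_lower Ys Xs.
have h := psd_proj_lip Ys Xs.
have := le_trans (ler_norm _) (mxdot_CS_le h (lexx (mxfnorm (Y - X)))).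
rewrite -expr2 -[X - Y]opprB mxdotNr; move: (psd_proj X) (psd_proj Y) {h} => PX PY.
rewrite mxdotBl; move: (mxfnorm PX) (mxfnorm PY) (mxdot PX _) (mxdot PY _) => *; lra.
Qed.

(** Since [<Pi X, X> = |Pi X|^2], the trapezoidal error is exactly half of
    [<Pi Y, X> - <Pi X, Y>]. *)
Lemma theta_trapezoid X : symS X -> exists2 K, 0 <= K & forall Y, symS Y ->
  `|mxfnorm (psd_proj Y) ^+ 2 / 2 - mxfnorm (psd_proj X) ^+ 2 / 2
    - mxdot (psd_proj X + psd_proj Y) (Y - X) / 2| <= K * mxfnorm (Y - X) ^+ 3.
Proof.
move=> Xs; have [K K0 H] := psd_proj_trapezoid Xs.
exists K => // Y Ys; have := H Y Ys.
have -> : mxfnorm (psd_proj Y) ^+ 2 / 2 - mxfnorm (psd_proj X) ^+ 2 / 2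
    - mxdot (psd_proj X + psd_proj Y) (Y - X) / 2 =
    (mxdot (psd_proj Y) X - mxdot (psd_proj X) Y) / 2.
  move: (psd_proj_dot Xs) (psd_proj_dot Ys); move: (psd_proj X) (psd_proj Y) => PX PY EX EY.
  rewrite !sqr_mxfnorm mxdotDl !mxdotBr EX EY.
  by move: (mxdot PX PX) (mxdot PY PY) (mxdot PX Y) (mxdot PY X) => *; field.
rewrite normrM [`|2^-1|]ger0_norm// => h; apply: le_trans h.
by rewrite ler_piMr// invf_le1// ler1n.
Qed.

End HalfSquaredProjection.

(** * Symmetry and spectral bounds of the generalised derivative *)

Section UOperator.
Variables (R : realType) (n : nat) (P : 'M[R]_n) (lam : 'rV[R]_n).
Hypothesis P1 : P^T *m P = 1%:M.
Implicit Types X Y H : 'M[R]_n.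

Lemma Sigma_sym i j : Sigma_mx lam i j = Sigma_mx lam j i.
Proof. by rewrite !mxE; case: ltP => //; case: ltP. Qed.

Lemma Sigma_bounds i j : 0 <= Sigma_mx lam i j <= 1.
Proof.
have H (x y : R) : 0 < x -> y <= 0 -> 0 <= x / (x - y) <= 1.
  move=> x0 y0; have xy : 0 < x - y by lra.
  by apply/andP; split; [apply: divr_ge0; lra|rewrite ler_pdivrMr//; lra].
by rewrite mxE; case: ltP => i0; case: ltP => j0; rewrite ?ler01 ?lexx//; exact: H.
Qed.

Lemma U_opZD a X Y : U_op P lam (a *: X + Y) = a *: U_op P lam X + U_op P lam Y.
Proof.
rewrite /U_op scalemxAl scalemxAr -mulmxDl -mulmxDr [P^T *m (_ + _)]mulmxDr.
rewrite [(_ + _) *m P]mulmxDl -scalemxAr -scalemxAl; congr (_ *m _ *m _).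
by apply/matrixP => i j; rewrite !mxE; ring.
Qed.

Lemma U_op0 : U_op P lam 0 = 0.
Proof. by have := U_opB P lam 0 0; rewrite !subrr. Qed.

Lemma U_opN X : U_op P lam (- X) = - U_op P lam X.
Proof. by rewrite -[- X]sub0r U_opB U_op0 sub0r. Qed.

Lemma U_op_sym X : symS X -> symS (U_op P lam X).
Proof.
move=> Xs; rewrite /U_op -{1}[P]trmxK; apply: symS_congr.
have Ts : symS (P^T *m X *m P) by exact: symS_congr.
by apply/matrixP => i j; rewrite mxE [LHS]mxE [RHS]mxE Sigma_sym (symSE j i Ts).
Qed.

Lemma mxdot_U_op X Y : mxdot X (U_op P lam Y) =
  \sum_i \sum_j Sigma_mx lam i j * (P^T *m X *m P) i j * (P^T *m Y *m P) i j.
Proof.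
rewrite mxdotC mxdot_conj mxdotE; apply: eq_bigr => i _; apply: eq_bigr => j _.
by rewrite [in LHS]mxE; ring.
Qed.

Lemma mxdot_U_opC X Y : mxdot X (U_op P lam Y) = mxdot Y (U_op P lam X).
Proof.
by rewrite !mxdot_U_op; apply: eq_bigr => i _; apply: eq_bigr => j _; ring.
Qed.

Lemma mxdot_U_op_ge0 X : 0 <= mxdot X (U_op P lam X).
Proof.
rewrite mxdot_U_op; apply: sumr_ge0 => i _; apply: sumr_ge0 => j _.
rewrite -mulrA mulr_ge0//; first by have /andP[] := Sigma_bounds i j.
by rewrite -expr2 sqr_ge0.
Qed.

Lemma mxfnorm_U_op X : mxfnorm (U_op P lam X) <= mxfnorm X.
Proof.
rewrite mxfnorm_conj// -(mxfnorm_conjT X P1) mxfnorm_le !mxdotE.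
apply: ler_sum => i _; apply: ler_sum => j _; rewrite -!expr2 mxE exprMn.
have /andP[s0 s1] := Sigma_bounds i j.
by rewrite ler_piMl ?sqr_ge0// exprn_ile1.
Qed.

(** In the eigenbasis it suffices that [max(0, lam_i)^2 <= 2 |Y|^2 Sigma_ij]; for a mixed pair this
    amounts to [lam_i (lam_i - lam_j) <= 2 |Y|^2]. Hence the form of [U_Y] can be small only where
    [Pi(Y) H] is. *)
Lemma psd_proj_mul_bound Y H : Y = P *m diag_mx lam *m P^T ->
  mxfnorm (psd_proj Y *m H) ^+ 2 <= 2 * mxfnorm Y ^+ 2 * mxdot H (U_op P lam H).
Proof.
move=> YE; rewrite YE psd_proj_conj// mxfnorm_conj//.
rewrite -(mxfnorm_conjT (_ *m H) P1).
have -> : P^T *m (P *m diag_mx (map_mx (Num.max 0) lam) *m P^T *m H) *m P =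
   diag_mx (map_mx (Num.max 0) lam) *m (P^T *m H *m P).
  by rewrite !mulmxA P1 mul1mx.
rewrite sqr_mxfnorm mxdot_U_op mxdotE mulr_sumr; apply: ler_sum => i _.
rewrite mulr_sumr; apply: ler_sum => j _.
have Hl k : `|lam 0 k| <= mxfnorm (diag_mx lam).
  by have := mxentry_le_fnorm (diag_mx lam) k k; rewrite mxE eqxx.
have hi := Hl i; have hj := Hl j; have d0 := mxfnorm_ge0 (diag_mx lam).
rewrite mul_diag_mx 2!mxE; move: (mxfnorm _) ((_ *m _) i j) hi hj d0 => d h hi hj d0.
suff : Num.max 0 (lam 0 i) ^+ 2 <= 2 * d ^+ 2 * Sigma_mx lam i j.
  by have := sqr_ge0 h; nra.
rewrite [Sigma_mx _ _ _]mxE maxEle; case: (ltP 0 (lam 0 i)) => li; last first.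
  have -> : (if 0 <= lam 0 i then lam 0 i else 0) = 0.
    by case: leP => // h0; apply/eqP; rewrite eq_le li h0.
  have := Sigma_bounds i j; rewrite mxE expr0n/= => /andP[s0 _].
  by move: s0; rewrite ltNge li /= => s0; rewrite mulr_ge0// mulr_ge0// sqr_ge0.
rewrite (ltW li); rewrite gtr0_norm// in hi.
case: ltP => lj; first by nra.
rewrite ler0_norm// in hj.
rewrite mulrA ler_pdivlMr; last lra.
have h1 : lam 0 i * (lam 0 i - lam 0 j) <= d * (2 * d) by apply: ler_pM; lra.
by have := ler_wpM2l (ltW li) h1; lra.
Qed.

End UOperator.

(** * Conjugate gradients and inexact Newton steps *)

Section ConjugateGradient.
Variables (R : realType) (m n : nat).
Local Notation E := ('M[R]_n * 'cV[R]_m)%type.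
Variables (L : set E) (M : E -> E) (rhs : E).
Hypothesis L0 : L 0.
Hypothesis LZD : forall a u v, L u -> L v -> L (a *: u + v).
Hypothesis M_lin : forall a u v, M (a *: u + v) = a *: M u + M v.
Hypothesis M_dom : forall u, L u -> L (M u).
Hypothesis M_sym : forall u v, L u -> L v -> pdot u (M v) = pdot v (M u).
Hypothesis M_pos : forall u, L u -> pdot u (M u) <= 0 -> u = 0.
Hypothesis L_rhs : L rhs.

(* Each step decreases the quadratic model [<x, M x> / 2 - <rhs, x>], which starts
   at 0; this only needs [<r, p> = <r, r>], not the conjugacy of the directions. *)
Lemma cg_descent k : pdot (cg_iterate M rhs k) (M (cg_iterate M rhs k)) <=
  2 * pdot rhs (cg_iterate M rhs k).
Proof.
have M0 : M 0 = 0 by have := M_lin (-1) 0 0; rewrite scaleN1r addNr scaleN1r addNr.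
suff : let: (x, r, p) := cg_state M rhs k in
    [/\ L x, L p, r = rhs - M x, pdot r p = pdot r r & pdot x (M x) <= 2 * pdot rhs x].
  by rewrite /cg_iterate; case: (cg_state M rhs k) => -[x r] p [].
elim: k => [|k] /=.
  by split => //; rewrite ?M0 ?subr0 ?pdot0r ?mulr0.
case: (cg_state M rhs k) => -[x r] p [Lx Lp rE rp q].
have Lr : L r.
  by rewrite rE addrC -scaleN1r; apply: LZD => //; exact: M_dom.
set a := pdot r r / pdot p (M p); set c := _ / pdot r r.
have aE : pdot r r = a * pdot p (M p).
  (* On breakdown definiteness gives [p = 0], hence [<r, r> = <r, p> = 0], and the default value of
     the division keeps the identity true. *)
  have [p0|pn0] := eqVneq (pdot p (M p)) 0; last by rewrite /a divfK.
  have {}p0 : p = 0 by apply: M_pos => //; rewrite p0.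
  by rewrite -rp p0 M0 !pdot0r mulr0.
have a0 : 0 <= a.
  rewrite /a mulr_ge0 ?pdot_ge0// invr_ge0.
  rewrite leNgt; apply/negP => h.
  by move: (h); rewrite (M_pos Lp (ltW h)) M0 pdot0r ltxx.
have LMp : L (M p) by exact: M_dom.
have Lr' : L (r - a *: M p) by rewrite addrC -scaleNr; exact: LZD.
have r'p : pdot (r - a *: M p) p = 0.
  by rewrite pdotBl rp aE pdotZl [pdot (M p) p]pdotC subrr.
have xp : x + a *: p = a *: p + x by rewrite addrC.
have Mx' : M (x + a *: p) = M x + a *: M p by rewrite xp M_lin addrC.
split.
- by rewrite xp; exact: LZD.
- by rewrite addrC; exact: LZD.
- by rewrite Mx' rE opprD addrA.
- by rewrite pdotDr pdotZr r'p mulr0 addr0.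
rewrite Mx' !(pdotDl, pdotDr) !(pdotZl, pdotZr) (M_sym Lx Lp).
have rhsE : pdot rhs p = pdot r r + pdot p (M x).
  by rewrite -rp rE pdotBl [pdot (M x) p]pdotC subrK.
have aa : a * (a * pdot p (M p)) = a * pdot r r by rewrite -aE.
have := mulr_ge0 a0 (pdot_ge0 r); rewrite rhsE; move: aa q; clearbody a.
move: (pdot p (M p)) (pdot r r) (pdot x (M x)) (pdot p (M x)) (pdot rhs x) => *.
lra.
Qed.

End ConjugateGradient.

(** * An abstract inexact Newton method with Armijo backtracking on a subspace *)

Section InexactNewton.
Variables (R : realType) (m n : nat).
Local Notation E := ('M[R]_n * 'cV[R]_m)%type.
Variables (L : set E) (f : E -> R) (G : E -> E) (V : nat -> E -> E).
Variables (z d : nat -> E) (k : nat -> nat) (zbar : E).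
Variables (mu etabar tau delta K1 K2 K3 K4 K5 c r : R).
Hypothesis LZD : forall a u v, L u -> L v -> L (a *: u + v).
Hypothesis mu_bnd : 0 < mu < 2^-1.
Hypothesis eta_bnd : 0 < etabar < 1.
Hypothesis tau_bnd : 0 < tau <= 1.
Hypothesis delta_bnd : 0 < delta < 1.
Hypothesis K_ge0 : [/\ 0 <= K1, 0 <= K2, 0 <= K3, 0 <= K4 & 0 <= K5].
Hypothesis c0 : 0 < c.
Hypothesis r0 : 0 < r.
Hypothesis f_quad : forall u u' h, u' = u + h -> L u -> L h ->
  f u + pdot (G u) h <= f u' <= f u + pdot (G u) h + K1 * pnorm h ^+ 2.
Hypothesis G_lip : forall u u' h, u' = u + h -> L u -> L h ->
  pnorm (G u' - G u) <= K2 * pnorm h.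
Hypothesis f_trap : forall u h, u = zbar + h -> L h ->
  `|f u - f zbar - pdot (G zbar + G u) h / 2| <= K3 * pnorm h ^+ 3.
Hypothesis V_bnd : forall j u, pnorm (V j u) <= K4 * pnorm u.
Hypothesis V_lin : forall j a u v, V j (a *: u + v) = a *: V j u + V j v.
(** The second error term pays for the regularisation, whose coefficient is at most the gradient
    norm. *)
Hypothesis V_semismooth : forall j h, z j = zbar + h -> L h ->
  pnorm (G (z j) - G zbar - V j h) <= K5 * pnorm h ^+ 2 + pnorm (G (z j)) * pnorm h.
Hypothesis V_pd : forall j h, z j = zbar + h -> L h -> pnorm h <= r ->
  forall u, L u -> c * pnorm u ^+ 2 <= pdot u (V j u).
Hypothesis z_dom : forall j, L (z j).
Hypothesis zbar_dom : L zbar.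
Hypothesis d_dom : forall j, L (d j).
Hypothesis d_res : forall j, pnorm (V j (d j) + G (z j)) <=
  Num.min etabar (pnorm (G (z j)) `^ (1 + tau)).
Hypothesis d_descent0 : forall j, pdot (G (z j)) (d j) <= 0.
Hypothesis d_descent : forall j, G (z j) <> 0 ->
  pdot (d j) (V j (d j)) <= - (2 * pdot (G (z j)) (d j)).
Let armijo_ j l := f (z j + delta ^+ l *: d j)
  <= f (z j) + mu * delta ^+ l * pdot (G (z j)) (d j).
Hypothesis armijo_k : forall j, armijo_ j (k j).
Hypothesis armijo_first : forall j l, (l < k j)%N -> ~ armijo_ j l.
Hypothesis z_step : forall j, z j.+1 = z j + delta ^+ (k j) *: d j.
Hypothesis z_accum : forall e J, 0 < e -> exists2 j, (J <= j)%N & pnorm (z j - zbar) <= e.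

Let LB u v : L u -> L v -> L (u - v).
Proof. by move=> Lu Lv; rewrite addrC -scaleN1r; exact: LZD. Qed.

Let LZ a u : L u -> L (a *: u).
Proof.
move=> Lu; have L0 : L 0 by rewrite -(subrr u); exact: LB.
by rewrite -[_ *: _]addr0; exact: LZD.
Qed.

Lemma newton_decreasing i j : (i <= j)%N -> f (z j) <= f (z i).
Proof.
elim: j => [|j IH]; first by rewrite leqn0 => /eqP ->.
rewrite leq_eqVlt ltnS => /orP[/eqP -> //|/IH]; apply: le_trans.
rewrite z_step; apply: le_trans (armijo_k j) _; rewrite gerDl.
case/andP: mu_bnd => mu0 _; case/andP: delta_bnd => de0 _.
by rewrite mulr_ge0_le0// mulr_ge0// ?exprn_ge0// ltW.
Qed.

(** Late iterates come arbitrarily close to [zbar], where the first-order lower bound makes their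
    values nearly as large as [f zbar]; by monotonicity those values are at most [f (z j)]. *)
Lemma newton_above j : f zbar <= f (z j).
Proof.
apply/ler_addgt0Pr => e e0.
have g0 : 0 < pnorm (G zbar) + 1 by rewrite ltr_wpDl// pnorm_ge0.
have [i ji Hi] := z_accum j (divr_gt0 e0 g0).
apply: (@le_trans _ _ (f (z i) + e)); last by rewrite lerD2r newton_decreasing.
have /andP[h _] := f_quad (u := zbar) (u' := z i) (h := z i - zbar)
  (esym (subrKC _ _)) zbar_dom (LB (z_dom i) zbar_dom).
have h2 : - pdot (G zbar) (z i - zbar) <= e.
  apply: le_trans (ler_norm _) _; rewrite normrN; apply: le_trans (pdot_CS _ _) _.
  move: Hi; rewrite ler_pdivlMr//; have := pnorm_ge0 (z i - zbar); lra.
by move: h h2; lra.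
Qed.

(** Split at [q], the midpoint of [etabar] and 1. Above it the gap is at least [(1 - etabar) / 2];
    below it [s (1 - s^tau) >= s0 (1 - q^tau)]. With [|V d| >= |G| - residual] this bounds the
    direction away from 0. *)
Lemma residual_gap (s0 : R) : 0 < s0 -> exists2 e, 0 < e &
  forall s, s0 <= s -> e <= s - Num.min etabar (s `^ (1 + tau)).
Proof.
move=> s00; case/andP: eta_bnd => e0 e1; case/andP: tau_bnd => t0 t1.
pose q := (1 + etabar) / 2.
have q0 : 0 < q by rewrite /q; lra.
have q1 : q < 1 by rewrite /q; lra.
have qt : q `^ tau < 1.
  have : q `^ tau < 1 `^ tau by apply: gt0_ltr_powR; rewrite ?nnegrE// ltW.
  by rewrite powR1.
exists (Num.min ((1 - etabar) / 2) (s0 * (1 - q `^ tau))).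
  by rewrite lt_min; apply/andP; split; [lra|rewrite mulr_gt0// subr_gt0].
move=> s s0s; have sp : 0 < s by exact: lt_le_trans s0s.
have [qs|sq] := leP q s.
  apply: (@le_trans _ _ (s - etabar)); last by rewrite lerD2l lerN2 ge_min lexx.
  by rewrite ge_min; apply/orP; left; move: qs; rewrite /q; lra.
apply: (@le_trans _ _ (s - s `^ (1 + tau))); last first.
  by rewrite lerD2l lerN2 ge_min lexx orbT.
rewrite powRD; last by apply/implyP => _; rewrite gt_eqF.
rewrite powRr1; last exact: ltW.
rewrite ge_min; apply/orP; right.
have -> : s - s * s `^ tau = s * (1 - s `^ tau) by ring.
apply: ler_pM => //; first exact: ltW.
  by rewrite subr_ge0 ltW.
by rewrite lerD2l lerN2 ge0_ler_powR ?nnegrE// ltW.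
Qed.

Lemma newton_stationary : G zbar = 0.
Proof.
case: K_ge0 => K10 K20 K30 K40 K50.
case/andP: mu_bnd => mu0 mu1; case/andP: delta_bnd => de0 de1.
apply/pnorm_eq0/eqP/negP => /negP gn0.
have g0 : 0 < pnorm (G zbar) by rewrite lt0r gn0 pnorm_ge0.
set ga := pnorm (G zbar) in g0.
have [e1 e10 He1] := residual_gap (divr_gt0 g0 (ltr0n R 2)).
have K41 : 0 < K4 + 1 by rewrite ltr_wpDl.
(* [d0] bounds [|d_j|] from below and [s0] bounds [- <G, d_j>] from below, the latter by CG descent
   and definiteness of [V]. *)
pose d0 := e1 / (K4 + 1); have d00 : 0 < d0 by rewrite divr_gt0.
pose s0 := c / 2 * d0 ^+ 2; have s00 : 0 < s0 by rewrite mulr_gt0 ?divr_gt0 ?exprn_gt0.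
have K11 : 0 < 2 * (K1 + 1) by rewrite mulr_gt0// ltr_wpDl.
(* A rejected trial [t] satisfies [(1 - mu) s < K1 t |d|^2 <= 2 K1 t s / c] with [s = - <G, d>],
   hence [t > (1 - mu) c / (2 (K1 + 1))]. The accepted step is 1 or [delta] times a rejected
   trial. *)
pose t0 := Num.min 1 (delta * ((1 - mu) * c / (2 * (K1 + 1)))).
have mu1' : 0 < 1 - mu by lra.
have t00 : 0 < t0 by rewrite lt_min ltr01/= mulr_gt0// divr_gt0// mulr_gt0.
pose om := mu * t0 * s0; have om0 : 0 < om by rewrite mulr_gt0// mulr_gt0.
(* Within [rho] of [zbar] the operator is definite, the gradient keeps half its norm, and [f]
   exceeds [f zbar] by at most [om / 2]; a decrease by [om] then contradicts [newton_above]. *)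
pose rho := Num.min r (Num.min 1 (Num.min (ga / 2 / (K2 + 1)) (om / 2 / (ga + K1 + 1)))).
have K21 : 0 < K2 + 1 by rewrite ltr_wpDl.
have gK : 0 < ga + K1 + 1 by rewrite ltr_wpDl// addr_ge0// ltW.
have rho0 : 0 < rho.
  rewrite !lt_min r0 ltr01/=; apply/andP; split; apply: divr_gt0 => //; exact: divr_gt0.
have [j _ Hj] := z_accum 0 rho0.
pose h := z j - zbar; have zh : z j = zbar + h by rewrite subrKC.
have Lh : L h by exact: LB.
have hr : pnorm h <= r by apply: le_trans Hj _; rewrite ge_min lexx.
have h1 : pnorm h <= 1 by apply: le_trans Hj _; rewrite !ge_min lexx !orbT.
have h2 : pnorm h * (K2 + 1) <= ga / 2.
  by rewrite -ler_pdivlMr//; apply: le_trans Hj _; rewrite !ge_min lexx !orbT.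
have h3 : pnorm h * (ga + K1 + 1) <= om / 2.
  by rewrite -ler_pdivlMr//; apply: le_trans Hj _; rewrite !ge_min lexx !orbT.
have hp := pnorm_ge0 h.
have gz : ga / 2 <= pnorm (G (z j)).
  have := G_lip zh zbar_dom Lh; rewrite pnorm_distC => hl.
  have := pnormD (G zbar - G (z j)) (G (z j)); rewrite subrK -/ga.
  by move: hl; lra.
have Gn0 : G (z j) <> 0.
  by move=> G0; move: gz; rewrite G0 pnorm0; lra.
have dd0 : d0 <= pnorm (d j).
  rewrite /d0 ler_pdivrMr//; apply: le_trans (He1 _ gz) _.
  have := pnormB (V j (d j) + G (z j)) (V j (d j)).
  have -> : V j (d j) + G (z j) - V j (d j) = G (z j) by rewrite addrAC subrr add0r.
  have := d_res j; have := V_bnd j (d j).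
  by have := pnorm_ge0 (d j); lra.
set s := - pdot (G (z j)) (d j).
have cs : c / 2 * pnorm (d j) ^+ 2 <= s.
  by have := V_pd zh Lh hr (d_dom j); have := d_descent Gn0; rewrite /s; lra.
have s0s : s0 <= s.
  apply: le_trans cs; rewrite /s0 ler_wpM2l//; first by rewrite ltW// divr_gt0.
  by rewrite ler_pXn2r// nnegrE ?pnorm_ge0// ltW.
have t0k : t0 <= delta ^+ (k j).
  case kE : (k j) => [|l]; first by rewrite expr0 ge_min lexx.
  have := armijo_first (j := j) (l := l); rewrite kE ltnSn => /(_ isT)/negP.
  rewrite -ltNge => hlt.
  have /andP[_ hup] := f_quad (erefl (z j + delta ^+ l *: d j)) (z_dom j) (LZ _ (d_dom j)).
  have := lt_le_trans hlt hup.
  have dl0 : 0 < delta ^+ l by rewrite exprn_gt0.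
  rewrite pdotZr pnormZ (gtr0_norm dl0) exprMn (exprS delta l).
  have -> : pdot (G (z j)) (d j) = - s by rewrite /s opprK.
  move: (delta ^+ l) dl0 (f (z j)) (pnorm (d j) ^+ 2) cs (sqr_ge0 (pnorm (d j))).
  move=> t tp fz D csD D0 hh.
  rewrite ge_min; apply/orP; right; rewrite ler_pM2l//.
  rewrite ler_pdivrMr//.
  have sp : 0 < s by exact: lt_le_trans s0s.
  have hh2 : (1 - mu) * s < K1 * t * D.
    rewrite -(ltr_pM2l tp).
    by lra.
  have hh3 : K1 * t * D * c <= K1 * t * (2 * s).
    rewrite -[_ * D * c]mulrA; apply: ler_wpM2l; first by rewrite mulr_ge0// ltW.
    lra.
  rewrite -(ler_pM2r sp).
  have hh4 : (1 - mu) * s * c <= K1 * t * D * c by rewrite ler_pM2r// ltW.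
  have := mulr_ge0 (ltW tp) (ltW sp); lra.
have hdec : f (z j.+1) <= f (z j) - om.
  rewrite z_step; apply: le_trans (armijo_k j) _.
  have -> : pdot (G (z j)) (d j) = - s by rewrite /s opprK.
  rewrite mulrN lerD2l lerN2 /om; apply: ler_pM; last exact: s0s.
  - by rewrite mulr_ge0// ltW.
  - exact: ltW.
  - by apply: ler_wpM2l; first exact: ltW.
have /andP[_ hup] := f_quad zh zbar_dom Lh.
have := newton_above j.+1.
have hG := pdot_le (G zbar) h.
have hsq : K1 * pnorm h ^+ 2 <= K1 * pnorm h.
  by rewrite ler_wpM2l// expr2 ler_piMr.
rewrite -/ga in hG; move: hG hsq hdec hup; move: (f (z j.+1)) (f (z j)) (f zbar) => f2 f1 f0.
by move=> *; lra.
Qed.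

Lemma newton_local : exists K r1, [/\ 0 <= K, 0 < r1 & forall j, pnorm (z j - zbar) <= r1 ->
  pnorm (z j.+1 - zbar) <= K * pnorm (z j - zbar) `^ (1 + tau) /\
  pnorm (z j.+1 - zbar) <= pnorm (z j - zbar) / 2].
Proof.
have G0 := newton_stationary.
case: K_ge0 => K10 K20 K30 K40 K50.
case/andP: mu_bnd => mu0 mu1; case/andP: tau_bnd => tau0 tau1.
(* With [x = z_j + d_j - zbar], [V x] is the CG residual minus the semismoothness error. The three
   terms bound these two in units of [s^(1 + tau)], and [1 / c] inverts [V]. *)
pose K6 := (K2 `^ (1 + tau) + K5 + K2) / c.
have K60 : 0 <= K6.
  by apply: divr_ge0; [apply: addr_ge0 => //; apply: addr_ge0 => //; exact: powR_ge0|exact: ltW].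
have K6E : K6 * c = K2 `^ (1 + tau) + K5 + K2 by rewrite /K6 divfK// gt_eqF.
clearbody K6.
(* The error budget of the Armijo test in units of [s^2 w], [w = s^tau]: upper bound at the new
   point, trapezoidal error, semismoothness in [<G, h>], and [<G, x>]. *)
pose KK := K1 * K6 ^+ 2 + K3 + (K5 + K2) + K2 * K6.
have KK0 : 0 <= KK.
  exact: addr_ge0 (addr_ge0 (addr_ge0 (mulr_ge0 K10 (sqr_ge0 _)) K30)
    (addr_ge0 K50 K20)) (mulr_ge0 K20 K60).
have KK1 : 0 < KK + 1 by rewrite ltr_wpDl.
have K61 : 0 < K6 + 1 by rewrite ltr_wpDl.
have mup : 0 < 2^-1 - mu by lra.
(* The second entry lets [(1/2 - mu) c s^2] absorb the budget [KK]; the third gives [K6 w <= 1/2],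
   hence the halving. The radius [w0^(1/tau)] turns these into conditions on [s]. *)
pose w0 := Num.min 1 (Num.min ((2^-1 - mu) * c / (KK + 1)) (2^-1 / (K6 + 1))).
have w00 : 0 < w0.
  by rewrite !lt_min ltr01/=; apply/andP; split; apply: divr_gt0; rewrite ?mulr_gt0 ?invr_gt0.
pose r1 := Num.min r (Num.min 1 (w0 `^ tau^-1)).
have r10 : 0 < r1 by rewrite !lt_min r0 ltr01/= powR_gt0.
exists K6, r1; split => // j Hj.
pose h := z j - zbar; have zh : z j = zbar + h by rewrite subrKC.
have Lh : L h by exact: LB.
have hr : pnorm h <= r by apply: le_trans Hj _; rewrite ge_min lexx.
have h1 : pnorm h <= 1 by apply: le_trans Hj _; rewrite !ge_min lexx !orbT.
have hw : pnorm h <= w0 `^ tau^-1 by apply: le_trans Hj _; rewrite !ge_min lexx !orbT.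
rewrite -/h; set s := pnorm h in h1 hw hr *.
have s0 : 0 <= s := pnorm_ge0 h.
have powS x : 0 <= x -> x `^ (1 + tau) = x * x `^ tau.
  move=> x0; rewrite powRD ?powRr1//; apply/implyP => /eqP; lra.
rewrite powS//; set w := s `^ tau.
have w1 : 0 <= w := powR_ge0 _ _.
have ww0 : w <= w0.
  have -> : w0 = (w0 `^ tau^-1) `^ tau.
    by rewrite -powRrM mulVf ?gt_eqF// powRr1// ltW.
  by rewrite ge0_ler_powR ?nnegrE ?powR_ge0// ltW.
have sw : s <= w.
  have [->|sn0] := eqVneq s 0; first exact: w1.
  have sp : 0 < s by rewrite lt0r sn0.
  by rewrite -[leLHS]powRr1// /w ger_powR// sp h1.
have wl1 : w <= 1 by apply: le_trans ww0 _; rewrite ge_min lexx.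
have w2 : w * (KK + 1) <= (2^-1 - mu) * c.
  by rewrite -ler_pdivlMr//; apply: le_trans ww0 _; rewrite !ge_min lexx !orbT.
have w3 : w * (K6 + 1) <= 2^-1.
  by rewrite -ler_pdivlMr//; apply: le_trans ww0 _; rewrite !ge_min lexx !orbT.
have gK : pnorm (G (z j)) <= K2 * s.
  by have := G_lip zh zbar_dom Lh; rewrite G0 subr0.
have g0 := pnorm_ge0 (G (z j)).
have semi : pnorm (G (z j) - V j h) <= K5 * s ^+ 2 + K2 * s * s.
  have := V_semismooth zh Lh; rewrite G0 subr0 => /le_trans; apply.
  by rewrite lerD2l ler_wpM2r.
have res : pnorm (V j (d j) + G (z j)) <= K2 `^ (1 + tau) * (s * w).
  apply: le_trans (d_res j) _; apply: (@le_trans _ _ (pnorm (G (z j)) `^ (1 + tau))).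
    by rewrite ge_min lexx orbT.
  rewrite -powS// -powRM//; apply: ge0_ler_powR => //; rewrite ?nnegrE ?mulr_ge0//.
  by rewrite addr_ge0// ltW.
pose x := h + d j.
have Lx : L x by rewrite /x -[h]scale1r; exact: LZD.
have xK : pnorm x <= K6 * (s * w).
  have Vx : pnorm (V j x) <= (K2 `^ (1 + tau) + K5 + K2) * (s * w).
    have -> : V j x = (V j (d j) + G (z j)) - (G (z j) - V j h).
      by rewrite /x -[h in LHS]scale1r V_lin scale1r opprB addrACA addrN addr0 addrC.
    apply: le_trans (pnormB _ _) _.
    have h2 : s ^+ 2 <= s * w by rewrite expr2 ler_wpM2l.
    have := ler_wpM2l K50 h2; have := ler_wpM2l K20 h2; move: res semi; lra.
  rewrite -(ler_pM2r c0) [leRHS]mulrAC K6E.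
  have := V_pd zh Lh hr Lx; have := pdot_le x (V j x); have := pnorm_ge0 x.
  have [->|xn0] := eqVneq (pnorm x) 0.
    move=> _ _ _; rewrite mul0r; exact: le_trans (pnorm_ge0 _) Vx.
  move=> x0 hx1 hx2; have xp : 0 < pnorm x by rewrite lt0r xn0.
  have := le_trans hx2 hx1; rewrite expr2 mulrCA ler_pM2l// => /le_trans; rewrite mulrC; apply.
  exact: Vx.
(* Comparing both values with [f zbar], it suffices that [K1 |x|^2 + K3 s^3 <= (1/2 - mu) <G, h> +
   mu <G, x>], where [<G, h> >= c s^2 - (K5 + K2) s^3]. The 1/2 is the trapezoidal weight, whence
   the role of [mu < 1/2]. *)
have arm : armijo_ j 0.
  rewrite /armijo_ expr0 scale1r mulr1.
  have zd : z j + d j = zbar + x by rewrite /x addrA -zh.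
  have /andP[_ up] := f_quad zd zbar_dom Lx.
  have := f_trap zh Lh; rewrite ler_norml => /andP[tr _].
  rewrite G0 -/s in up tr.
  have z0 u : pdot (0 : E) u = 0 by rewrite pdotC pdot0r.
  rewrite z0 in up; rewrite add0r in tr.
  have dx : d j = x - h by rewrite /x addrC addKr.
  have Gd : pdot (G (z j)) (d j) = pdot (G (z j)) x - pdot (G (z j)) h by rewrite dx pdotBr.
  have Gh : c * s ^+ 2 - (K5 * s ^+ 2 + K2 * s * s) * s <= pdot (G (z j)) h.
    have := V_pd zh Lh hr Lh; rewrite -/s.
    have := pdot_le (- (G (z j) - V j h)) h; rewrite pnormN -/s pdotNl pdotBl.
    by rewrite [pdot (V j h) h]pdotC; have := ler_wpM2r s0 semi; lra.
  have Gx : - pdot (G (z j)) x <= K2 * s * (K6 * (s * w)).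
    apply: le_trans (ler_norm _) _; rewrite normrN; apply: le_trans (pdot_CS _ _) _.
    by apply: ler_pM; rewrite ?pnorm_ge0.
  have xx : pnorm x ^+ 2 <= K6 ^+ 2 * s ^+ 2 * w.
    apply: (@le_trans _ _ ((K6 * (s * w)) ^+ 2)).
      have xK0 := le_trans (pnorm_ge0 x) xK.
      by rewrite ler_pXn2r// nnegrE// pnorm_ge0.
    rewrite !exprMn mulrA; apply: ler_wpM2l; first exact: mulr_ge0 (sqr_ge0 _) (sqr_ge0 _).
    by rewrite expr2 ler_piMl.
  have s3 : s ^+ 3 <= s ^+ 2 * w by rewrite exprSr ler_wpM2l// sqr_ge0.
  have s20 : 0 <= s ^+ 2 by exact: sqr_ge0.
  rewrite Gd.
  have t1 : K1 * pnorm x ^+ 2 <= K1 * (K6 ^+ 2 * s ^+ 2 * w) by rewrite ler_wpM2l.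
  have t2 : K3 * s ^+ 3 <= K3 * (s ^+ 2 * w) by rewrite ler_wpM2l.
  have t3 : (K5 + K2) * s ^+ 3 <= (K5 + K2) * (s ^+ 2 * w) by rewrite ler_wpM2l// addr_ge0.
  have t4 : (2^-1 - mu) * (c * s ^+ 2 - (K5 + K2) * s ^+ 3) <= (2^-1 - mu) * pdot (G (z j)) h.
    by rewrite ler_pM2l//; apply: le_trans Gh; lra.
  have sw0 : 0 <= s ^+ 2 * w by rewrite mulr_ge0.
  have kk0 : 0 <= (K5 + K2) * (s ^+ 2 * w) by rewrite mulr_ge0// addr_ge0.
  have t5 : (2^-1 - mu) * ((K5 + K2) * s ^+ 3) <= (K5 + K2) * (s ^+ 2 * w).
    apply: (@le_trans _ _ ((2^-1 - mu) * ((K5 + K2) * (s ^+ 2 * w)))).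
      by rewrite ler_pM2l.
    by rewrite ler_piMl//; lra.
  have kk1 : 0 <= K2 * s * (K6 * (s * w)) by rewrite !mulr_ge0.
  have t6 : mu * - pdot (G (z j)) x <= K2 * s * (K6 * (s * w)).
    apply: (@le_trans _ _ (mu * (K2 * s * (K6 * (s * w))))).
      by rewrite ler_pM2l.
    by rewrite ler_piMl//; lra.
  have t7 := ler_wpM2l s20 w2.
  rewrite /KK in t7.
  move: up tr t1 t2 t4 t5 t6 t7 sw0.
  move: (f (z j + d j)) (f (z j)) (f zbar) (pdot (G (z j)) h) (pdot (G (z j)) x) (pnorm x ^+ 2).
  move=> F1 F2 F3 gh gx X2 up tr t1 t2 t4 t5 t6 t7 sw0.
  lra.
have kj : k j = 0%N.
  by apply/eqP; rewrite -leqn0 leqNgt; apply/negP => /armijo_first; apply.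
have zx : z j.+1 - zbar = x.
  by rewrite z_step kj expr0 scale1r /x /h addrAC.
rewrite zx; split=> //; apply: le_trans xK _; rewrite mulrCA ler_wpM2l//.
by move: w3; lra.
Qed.

Lemma newton_converges :
  (forall e, 0 < e -> exists J, forall j, (J <= j)%N -> pnorm (z j - zbar) <= e) /\
  (exists K J, forall j, (J <= j)%N ->
    pnorm (z j.+1 - zbar) <= K * pnorm (z j - zbar) `^ (1 + tau)).
Proof.
have [K [r1 [K0 r10 H]]] := newton_local.
(* Halving makes every ball of radius at most [r1] about [zbar] invariant, so a single visit
   suffices. *)
have stay e : 0 < e -> e <= r1 -> exists J, forall j, (J <= j)%N -> pnorm (z j - zbar) <= e.
  move=> e0 er; have [J _ HJ] := z_accum 0 e0.
  exists J; elim=> [|j IH]; first by rewrite leqn0 => /eqP J0; move: HJ; rewrite J0.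
  rewrite leq_eqVlt ltnS => /orP[/eqP <- //|/IH Hj].
  have [_ h] := H j (le_trans Hj er).
  by apply: le_trans h _; have := pnorm_ge0 (z j - zbar); lra.
split=> [e e0|].
  have m0 : 0 < Num.min e r1 by rewrite lt_min e0.
  have [|J HJ] := stay _ m0; first by rewrite ge_min lexx orbT.
  by exists J => j /HJ; rewrite le_min => /andP[].
have [J HJ] := stay _ r10 (lexx _).
by exists K, J => j /HJ /H[].
Qed.

End InexactNewton.

(** * Constraint nondegeneracy and the dual objective *)

Section Nondegeneracy.
Variables (R : realType) (n : nat).
Implicit Types (Z H D : 'M[R]_n).

Lemma cvg_mxfnorm_ex (D : nat -> 'M[R]_n) H (e : R) : D @ \oo --> H -> 0 < e ->
  exists k, mxfnorm (D k - H) <= e.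
Proof.
move=> DH e0; have c0 : 0 < (n * n)%:R + 1 :> R by rewrite ltr_wpDl.
move/cvgrPdist_le : DH => /(_ _ (divr_gt0 e0 c0)) /filter_ex[k Hk].
exists k; apply: le_trans (mxfnorm_le_norm _) _; rewrite distrC.
move: Hk; rewrite ler_pdivlMr// => Hk; apply: le_trans Hk; rewrite mulrC.
by rewrite ler_wpM2l// lerDl.
Qed.

Lemma tangent_cone_psd_sym Z H : psdS Z -> tangent_cone (@psdS R n) Z H -> symS H.
Proof.
move=> Zp [t [D [t0 _ DH ZD]]].
have Ds k : symS (D k).
  have -> : D k = (t k)^-1 *: (Z + t k *: D k - Z).
    by rewrite [Z + _]addrC addrK scalerA mulVf ?scale1r// gt_eqF.
  by apply: symSZ; apply: symSB; [case: (ZD k)|case: Zp].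
apply/eqP; rewrite eq_sym -subr_eq0; apply/eqP; apply: mxfnorm_eq0.
apply/eqP; rewrite eq_le mxfnorm_ge0 andbT; apply/ler_addgt0Pl => e e0; rewrite addr0.
have e2 : 0 < e / 2 by rewrite divr_gt0.
have [k Hk] := cvg_mxfnorm_ex DH e2.
have -> : H - H^T = (D k - H)^T - (D k - H).
  by rewrite linearB /= Ds; apply/matrixP => i j; rewrite !mxE; ring.
by apply: le_trans (mxfnormB _ _) _; rewrite mxfnorm_tr; lra.
Qed.

(** On the kernel of [Z] the form of [Z + t D] is [t] times that of [D], so the sign passes to the
    limit. *)
Lemma tangent_cone_psd_ker Z H (v : 'cV[R]_n) : tangent_cone (@psdS R n) Z H ->
  Z *m v = 0 -> 0 <= mxdot v (H *m v).
Proof.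
move=> [t [D [t0 _ DH ZD]]] Zv.
have Dv k : 0 <= mxdot v (D k *m v).
  have := psd_ge0 (ZD k) v; rewrite mulmxDl Zv add0r -scalemxAl mxdotZr.
  by rewrite pmulr_rge0.
rewrite -[leRHS]addr0; apply/ler_addgt0Pr => e e0.
have c0 : 0 < mxfnorm v * mxfnorm v + 1 by rewrite ltr_wpDl// mulr_ge0// mxfnorm_ge0.
have [k Hk] := cvg_mxfnorm_ex DH (divr_gt0 e0 c0).
have : mxdot v ((D k - H) *m v) <= e.
  apply: le_trans (ler_norm _) _; apply: le_trans (mxdot_CS _ _) _.
  apply: (@le_trans _ _ (mxfnorm (D k - H) * (mxfnorm v * mxfnorm v + 1))).
    apply: (@le_trans _ _ (mxfnorm v * (mxfnorm (D k - H) * mxfnorm v))).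
      by rewrite ler_wpM2l ?mxfnorm_ge0 ?mxfnormM.
    by rewrite mulrCA ler_wpM2l ?mxfnorm_ge0// lerDl.
  by rewrite -ler_pdivlMr.
by rewrite mulmxBl mxdotBr addr0; have := Dv k; lra.
Qed.

(** Eigenvectors of [M] for nonzero eigenvalues lie in the kernel of [Z]. As [H] and [- H] are both
    tangent, the form of [H] vanishes on them, and [<H, M>] is a combination of these values. *)
Lemma lineality_psd_orth Z H M : psdS Z -> symS M -> Z *m M = 0 ->
  lineality (tangent_cone (@psdS R n) Z) H -> mxdot H M = 0.
Proof.
move=> Zp Ms ZM [V VT HV].
have H1 : tangent_cone (@psdS R n) Z H by exact: VT.
have H2 : tangent_cone (@psdS R n) Z (- H) by apply: VT; rewrite /= memvN.
have [P [mu [P1 ME]]] := sym_orthogonal_diag Ms.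
rewrite mxdotC ME mxdot_conj mxdot_diag big1// => k _.
have [->|mk] := eqVneq (mu 0 k) 0; first by rewrite mul0r.
have Zk : Z *m col k P = 0.
  have E : M *m col k P = mu 0 k *: col k P.
    by rewrite ME !colE -!mulmxA (mulmxA P^T) P1 mul1mx diag_mul_delta scalemxAr.
  have := congr1 (mulmx Z) E; rewrite mulmxA ZM mul0mx -scalemxAr => /esym/eqP.
  by rewrite scaler_eq0 (negPf mk) => /eqP.
rewrite entry_congr; have := tangent_cone_psd_ker H1 Zk.
have := tangent_cone_psd_ker H2 Zk; rewrite mulNmx mxdotNr oppr_ge0 => h1 h2.
by rewrite (_ : mxdot _ _ = 0) ?mulr0//; apply/eqP; rewrite eq_le h1 h2.
Qed.

End Nondegeneracy.

(** * The objective [phi], its gradient and the operators of the Newton systems *)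

Section Problem.
Variables (R : realType) (m n : nat).
Local Notation E := ('M[R]_n * 'cV[R]_m)%type.
Variables (Q : {linear 'M[R]_n -> 'M[R]_n}) (A : {linear 'M[R]_n -> 'cV[R]_m}).
Variables (Aadj : {linear 'cV[R]_m -> 'M[R]_n}).
Variables (b : 'cV[R]_m) (Chat : 'M[R]_n) (sigma : R).
Hypothesis Q_sym : forall X : 'M[R]_n, symS X -> symS (Q X).
Hypothesis Q_selfadj : forall X Y : 'M[R]_n, symS X -> symS Y ->
  mxdot X (Q Y) = mxdot (Q X) Y.
Hypothesis Q_psd : forall X : 'M[R]_n, symS X -> 0 <= mxdot X (Q X).
Hypothesis Aadj_sym : forall y : 'cV[R]_m, symS (Aadj y).
Hypothesis Aadj_adj : forall (X : 'M[R]_n) (y : 'cV[R]_m), symS X ->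
  mxdot (A X) y = mxdot X (Aadj y).
Hypothesis C_sym : symS Chat.
Hypothesis sigma_gt0 : 0 < sigma.

Local Notation L := (@phi_dom R m n Q).
Local Notation S_ := (S_map Q Aadj Chat).
Local Notation phi_ := (phi Q Aadj b Chat sigma).
(** The linear part of the affine map [S_map]. *)
Let T (h : E) : 'M[R]_n := Aadj h.2 - Q h.1.

Lemma dom_sym (h : E) : L h -> symS h.1.
Proof. by case=> -[X Xs <-] _; exact: Q_sym. Qed.

Lemma domZD a (g h : E) : L g -> L h -> L (a *: g + h).
Proof.
move=> [[X Xs Xg] _] [[Y Ys Yh] _]; split=> //=.
exists (a *: X + Y); first by apply: symSD => //; exact: symSZ.
by rewrite linearP Xg Yh.
Qed.

Lemma domD (g h : E) : L g -> L h -> L (g + h).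
Proof. by move=> Lg Lh; have := domZD 1 Lg Lh; rewrite scale1r. Qed.

Lemma dom0 : L 0.
Proof. by split=> //=; exists 0; [rewrite /symS /= trmx0|rewrite linear0]. Qed.

Lemma domZ a (g : E) : L g -> L (a *: g).
Proof. by move=> Lg; have := domZD a Lg dom0; rewrite addr0. Qed.

Lemma domN (g : E) : L g -> L (- g).
Proof. by rewrite -scaleN1r; exact: domZ. Qed.

Lemma domB (g h : E) : L g -> L h -> L (g - h).
Proof. by move=> Lg Lh; apply: domD => //; exact: domN. Qed.

Lemma S_sym (z : E) : symS z.1 -> symS (S_ z).
Proof. by move=> zs; apply: symSB => //; apply: symSB => //; exact: Q_sym. Qed.

Let T_sym (h : E) : symS h.1 -> symS (T h).
Proof. by move=> zs; apply: symSB => //; exact: Q_sym. Qed.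

Let S_add (z z' h : E) : z' = z + h -> S_ z' = S_ z + T h.
Proof.
move=> ->; rewrite /S_map /T /= !linearD /=.
by apply/matrixP => i j; rewrite !mxE; ring.
Qed.

Let T_linear a (g h : E) : T (a *: g + h) = a *: T g + T h.
Proof.
rewrite /T /= !linearP /=.
by apply/matrixP => i j; rewrite !mxE; ring.
Qed.

Let T_bounded : exists2 K, 0 <= K & forall h, mxfnorm (T h) <= K * pnorm h.
Proof.
have [K1 K10 H1] := linear_bounded Q; have [K2 K20 H2] := linear_bounded Aadj.
exists (K2 + K1); first exact: addr_ge0.
move=> h; apply: le_trans (mxfnormB _ _) _; rewrite mulrDl; apply: lerD.
  by apply: le_trans (H2 _) _; rewrite ler_wpM2l ?mxfnorm_snd.
by apply: le_trans (H1 _) _; rewrite ler_wpM2l ?mxfnorm_fst.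
Qed.

Definition gradE (z : E) : E :=
  (Q z.1 - sigma *: Q (psd_proj (S_ z)), - b + sigma *: A (psd_proj (S_ z))).

Lemma gradE_dom (z : E) : L z -> L (gradE z).
Proof.
move=> Lz; have zs := dom_sym Lz; split => //=.
exists (z.1 - sigma *: psd_proj (S_ z)); last by rewrite linearB linearZ.
by apply: symSB => //; apply: symSZ; apply: psd_proj_sym; exact: S_sym.
Qed.

Let pdot_gradE (z h : E) : symS z.1 -> symS h.1 ->
  pdot (gradE z) h = mxdot (Q z.1) h.1 - mxdot b h.2 + sigma * mxdot (psd_proj (S_ z)) (T h).
Proof.
move=> zs hs; have ps := psd_proj_sym (S_sym zs).
rewrite /pdot /= mxdotBl mxdotDl mxdotNl !mxdotZl Aadj_adj// -(Q_selfadj ps hs) mxdotBr.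
ring.
Qed.

Let phi_diff (z z' h : E) : z' = z + h -> symS z.1 -> symS h.1 ->
  phi_ z' - phi_ z = mxdot (Q z.1) h.1 - mxdot b h.2 + 2^-1 * mxdot h.1 (Q h.1)
   + sigma * (mxfnorm (psd_proj (S_ z + T h)) ^+ 2 / 2 - mxfnorm (psd_proj (S_ z)) ^+ 2 / 2).
Proof.
move=> zh zs hs; rewrite /phi (S_add zh); move: (S_ z) => X; move: (X + T h) => Y.
move: (mxfnorm (psd_proj X)) (mxfnorm (psd_proj Y)) => x y.
rewrite zh /= linearD /= !mxdotDl !mxdotDr (Q_selfadj zs hs) (mxdotC h.1 (Q z.1)).
by field.
Qed.

(** The lower bound is convexity, from psd [Q] and [theta_lower]; the upper one comes from
    [theta_upper]. *)
Lemma phi_upper : exists2 K, 0 <= K & forall z z' h, z' = z + h -> L z -> L h ->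
  phi_ z + pdot (gradE z) h <= phi_ z' <= phi_ z + pdot (gradE z) h + K * pnorm h ^+ 2.
Proof.
have [KT KT0 HT] := T_bounded; have [KQ KQ0 HQ] := linear_bounded Q.
exists (KQ + sigma * KT ^+ 2).
  by rewrite addr_ge0// mulr_ge0 ?sqr_ge0// ltW.
move=> z z' h zh /dom_sym zs /dom_sym hs.
have := phi_diff zh zs hs; rewrite pdot_gradE//.
have := S_sym zs; have := T_sym hs; have := HT h.
move: (S_ z) (T h) => X H HTh Hs Xs.
have := theta_upper Xs (symSD Xs Hs); have := theta_lower Xs (symSD Xs Hs).
have -> : X + H - X = H by rewrite addrC addKr.
move: (X + H) => Y; move: (psd_proj X) (psd_proj Y) => PX PY.
have sT : mxfnorm H ^+ 2 <= KT ^+ 2 * pnorm h ^+ 2.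
  by rewrite -exprMn ler_pXn2r// ?nnegrE ?mulr_ge0 ?mxfnorm_ge0 ?pnorm_ge0.
have q0 := Q_psd hs.
have q1 : mxdot h.1 (Q h.1) <= KQ * pnorm h ^+ 2.
  apply: le_trans (ler_norm _) _; apply: le_trans (mxdot_CS _ _) _.
  rewrite expr2 mulrCA; apply: ler_pM; rewrite ?mxfnorm_ge0 ?mxfnorm_fst//.
  by apply: le_trans (HQ _) _; rewrite ler_wpM2l ?mxfnorm_fst.
have ph2 := sqr_ge0 (pnorm h); move: sT q0 q1 ph2.
move: (mxdot h.1 _) (pnorm h ^+ 2) (mxdot b _) (mxdot _ h.1) => q N2 c1 c2 sT q0 q1 ph2.
move: (mxfnorm PX ^+ 2 / 2) (mxfnorm PY ^+ 2 / 2) (mxdot PX H) => t1 t2 p h1 h2.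
move: (phi_ z) (phi_ z') => f0 f1 h3.
have s1 : sigma * p <= sigma * (t2 - t1) by rewrite ler_pM2l//; lra.
have s2 : sigma * (t2 - t1) <= sigma * (p + KT ^+ 2 * N2).
  by rewrite ler_pM2l//; lra.
by apply/andP; split; [lra|rewrite mulrDl -mulrA; lra].
Qed.

(** The trapezoidal rule is exact on the quadratic and linear parts of [phi], so only the [theta]
    term contributes an error. *)
Lemma phi_trapezoid (z : E) : L z -> exists2 K, 0 <= K & forall z' h, z' = z + h -> L h ->
  `|phi_ z' - phi_ z - pdot (gradE z + gradE z') h / 2| <= K * pnorm h ^+ 3.
Proof.
move=> Lz; have zs := dom_sym Lz; have [KT KT0 HT] := T_bounded.
have [K K0 H] := theta_trapezoid (S_sym zs).
exists (sigma * (K * KT ^+ 3)); first by rewrite !mulr_ge0// ?exprn_ge0// ltW.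
move=> z' h zh Lh; have hs := dom_sym Lh.
have zhs : symS z'.1 by rewrite zh; exact: dom_sym (domD Lz Lh).
have zh1 : Q z'.1 = Q z.1 + Q h.1 by rewrite zh linearD.
have := pdot_gradE zhs hs; have := pdot_gradE zs hs; have := phi_diff zh zs hs.
move: (phi_ z') (phi_ z) (gradE z) (gradE z') => f1 f0 g0 g1 fE g0E g1E.
rewrite fE pdotDl g0E g1E zh1.
have := S_sym zhs; rewrite (S_add zh) => /H; have := HT h.
move: (S_ z) (T h) H => X U H HTh.
have -> : X + U - X = U by rewrite addrC addKr.
move: (X + U) => Y; move: (psd_proj X) (psd_proj Y) => PX PY.
move: (mxfnorm PX) (mxfnorm PY) => x y {}H; rewrite mxdotDl (mxdotC (Q h.1)).
rewrite mxdotDl in H; move: H; set u := _ - _ => H.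
rewrite [X in `|X|](_ : _ = sigma * u); last first.
  rewrite /u; move: (mxdot (Q _) _) (mxdot b _) (mxdot h.1 _) (mxdot PX _) (mxdot PY _) => *.
  by field.
rewrite normrM gtr0_norm// -mulrA ler_pM2l//; apply: le_trans H _.
by rewrite -mulrA ler_wpM2l// -exprMn ler_pXn2r// ?nnegrE ?mulr_ge0 ?mxfnorm_ge0 ?pnorm_ge0.
Qed.

Lemma is_gradient_gradE (z : E) : L z -> is_gradient L phi_ z (gradE z).
Proof.
move=> Lz; split; first exact: gradE_dom.
move=> e e0; have [K K0 H] := phi_upper.
have K1 : 0 < K + 1 by rewrite ltr_wpDl.
apply: filterS (near_pnorm_le 0 (divr_gt0 e0 K1)) => h; rewrite subr0 => he Lh.
have /andP[] := H z _ h erefl Lz Lh.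
have p0 := pnorm_ge0 h; move: p0 he.
move: (phi_ (z + h)) => f1; move: (phi_ z) (pdot _ h) (pnorm h) => f0 g p p0 he h1 h2.
rewrite ler_norml; apply/andP; split; first by have := mulr_ge0 (ltW e0) p0; lra.
apply: (@le_trans _ _ (K * p ^+ 2)); first lra.
by rewrite expr2 mulrA ler_wpM2r//; move: he; rewrite ler_pdivlMr//; nra.
Qed.

(** Both gradients lie in [L], so their difference [u] is an admissible direction; accuracy
    [|u| / 3] for each would give [|u|^2 <= (2/3) |u|^2]. *)
Lemma gradient_unique (f : E -> R) (z g g' : E) :
  is_gradient L f z g -> is_gradient L f z g' -> g = g'.
Proof.
move=> [Lg Hg] [Lg' Hg']; apply/eqP; rewrite -subr_eq0; apply/eqP; apply: pnorm_eq0.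
apply/eqP/negP => /negP u0; set u := g - g' in u0 *.
have up : 0 < pnorm u by rewrite lt0r u0 pnorm_ge0.
have e0 : 0 < pnorm u / 3 by rewrite divr_gt0.
have Lu : L u by exact: domB.
have H : \forall h \near (0 : E), L h -> `|pdot u h| <= 2 * (pnorm u / 3) * pnorm h.
  near=> h => Lh.
  have : `|f (z + h) - f z - pdot g' h| <= pnorm u / 3 * pnorm h.
    by move: Lh; near: h; exact: Hg'.
  have : `|f (z + h) - f z - pdot g h| <= pnorm u / 3 * pnorm h.
    by move: Lh; near: h; exact: Hg.
  rewrite pdotBl -[2 * _ * _]mulrA.
  move: (_ / 3 * _) (f _ - f _) (pdot g _) (pdot g' _) => e a b1 b2 h1 h2.
  have -> : b1 - b2 = (a - b2) - (a - b1) by ring.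
  by apply: le_trans (ler_normB _ _) _; lra.
have [t t0] := near0_ex_scale u H.
move=> /(_ (domZ t Lu)); rewrite pdotZr pnormZ -sqr_pnorm normrM (gtr0_norm t0).
rewrite ger0_norm ?sqr_ge0// [leRHS]mulrCA ler_pM2l// expr2.
have -> : 2 * (pnorm u / 3) * pnorm u = 2 / 3 * (pnorm u * pnorm u) by ring.
have : 0 < pnorm u * pnorm u by rewrite mulr_gt0.
by lra.
Unshelve. all: by end_near.
Qed.

(** [grad_phi] is defined by choice, so existence and uniqueness together identify it with the
    closed formula. *)
Lemma grad_phiE (z : E) : L z -> grad_phi Q Aadj b Chat sigma z = gradE z.
Proof.
move=> Lz; apply: xget_unique; first exact: is_gradient_gradE.
by move=> g Hg; apply: gradient_unique Hg _; exact: is_gradient_gradE.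
Qed.

Lemma pairB (u1 v1 : 'M[R]_n) (u2 v2 : 'cV[R]_m) :
  (u1, u2) - (v1, v2) = (u1 - v1, u2 - v2) :> E.
Proof. by []. Qed.

Lemma gradE_lip : exists2 K, 0 <= K & forall z z' h, z' = z + h -> L z -> L h ->
  pnorm (gradE z' - gradE z) <= K * pnorm h.
Proof.
have [KT KT0 HT] := T_bounded; have [KQ KQ0 HQ] := linear_bounded Q.
have [KA KA0 HA] := linear_bounded A.
exists (KQ + sigma * (KQ * KT) + sigma * (KA * KT)).
  by rewrite !addr_ge0 ?mulr_ge0// ltW.
move=> z z' h zh Lz Lh; have zs := dom_sym Lz.
have zhs : symS z'.1 by rewrite zh; exact: dom_sym (domD Lz Lh).
have zh1 : Q z'.1 = Q z.1 + Q h.1 by rewrite zh linearD.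
have := S_sym zhs; have := S_sym zs; rewrite /gradE (S_add zh) zh1.
move: (S_ z) (T h) (HT h) => X U HTh Xs XUs.
set F := psd_proj (X + U) - psd_proj X.
have FT : mxfnorm F <= KT * pnorm h.
  by apply: le_trans (psd_proj_lip XUs Xs) _; rewrite [X + U]addrC addrK.
rewrite [X in pnorm X](_ : _ = (Q h.1 - sigma *: Q F, sigma *: A F)); last first.
  rewrite /F; move: (psd_proj X) (psd_proj (X + U)) => PX PY.
  rewrite pairB (linearB Q) (linearB A); congr (_, _).
    by apply/matrixP => i j; rewrite !mxE; ring.
  by apply/matrixP => i j; rewrite !mxE; ring.
apply: le_trans (pnorm_le_sum _) _ => /=; rewrite mulrDl; apply: lerD.
  apply: le_trans (mxfnormB _ _) _; rewrite mulrDl; apply: lerD.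
    by apply: le_trans (HQ _) _; rewrite ler_wpM2l ?mxfnorm_fst.
  rewrite mxfnormZ gtr0_norm// -mulrA ler_pM2l//; apply: le_trans (HQ _) _.
  by rewrite -mulrA ler_wpM2l.
rewrite mxfnormZ gtr0_norm// -mulrA ler_pM2l//; apply: le_trans (HA _) _.
by rewrite -mulrA ler_wpM2l.
Qed.

(** [Q] is self-adjoint and psd on symmetric matrices only; symmetrising both arguments gives a
    semi-inner product on the whole matrix space. *)
Lemma Q_CS (X Y : 'M[R]_n) : symS X -> symS Y ->
  mxdot X (Q Y) ^+ 2 <= mxdot X (Q X) * mxdot Y (Q Y).
Proof.
pose s (X : 'M[R]_n) := 2^-1 *: (X + X^T).
have ss U : symS (s U) by rewrite /symS /s /= linearZ /= linearD /= trmxK addrC.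
have sE U : symS U -> s U = U.
  by move=> Us; rewrite /s Us -mulr2n -(scaler_nat 2 U) scalerA mulVf ?scale1r.
move=> Xs Ys.
have := @semidot_CS R _ (fun U V => mxdot (s U) (Q (s V))) _ _ _ _ X Y.
rewrite !sE//; apply => [U V|U V W|a U W|U]; last exact: Q_psd.
- by rewrite Q_selfadj// mxdotC.
- rewrite -mxdotDl; congr (mxdot _ _).
  by apply/matrixP => i j; rewrite !mxE; ring.
- rewrite -mxdotZl; congr (mxdot _ _).
  by apply/matrixP => i j; rewrite !mxE; ring.
Qed.

(** Composing [Q] with [X + X^T] gives a map on all matrices with range [Q(S^n)]; a section of it,
    symmetrised, yields symmetric preimages depending linearly on [W]. *)
Lemma range_section : exists g : {linear 'M[R]_n -> 'M[R]_n}, forall W,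
  (Q @` @symS R n) W -> Q (g W + (g W)^T) = W.
Proof.
pose f : {linear 'M[R]_n -> 'M[R]_n} := (Q \o (idfun \+ trmx))%FUN.
have [g fg] := linear_section f; exists g => _ [X Xs <-].
have fX : f (2^-1 *: X) = Q X.
  by rewrite /f /= linearZ /= Xs -scalerDr -mulr2n -(scaler_nat 2 X) scalerA mulVf ?scale1r.
by have := fg (2^-1 *: X); rewrite fX.
Qed.

(** The range of [Q] on symmetric matrices is the zero set of the bounded linear map [D]. This puts
    the accumulation point in the domain. *)
Lemma dom_closed (u0 : E) :
  (forall e, 0 < e -> exists2 u, L u & pnorm (u - u0) <= e) -> L u0.
Proof.
move=> H; have [g gE] := range_section.
pose D : {linear 'M[R]_n -> 'M[R]_n} := ((Q \o (idfun \+ trmx) \o g) \- idfun)%FUN.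
have [K K0 HK] := linear_bounded D.
have D0 W : (Q @` @symS R n) W -> D W = 0.
  by move=> /gE; rewrite /D /= => ->; rewrite subrr.
suff : D u0.1 = 0.
  rewrite /D /= => /eqP; rewrite subr_eq0 => /eqP Du; split => //=.
  exists (g u0.1 + (g u0.1)^T) => //.
  by rewrite /symS /= linearD /= trmxK addrC.
apply: mxfnorm_eq0; apply/eqP; rewrite eq_le mxfnorm_ge0 andbT.
apply/ler_addgt0Pl => e e0; rewrite addr0.
have K1 : 0 < K + 1 by rewrite ltr_wpDl.
have [u Lu Hu] := H _ (divr_gt0 e0 K1).
have -> : D u0.1 = - D (u.1 - u0.1) by rewrite (linearB D) (D0 _ (proj1 Lu)) sub0r opprK.
rewrite mxfnormN; apply: le_trans (HK _) _.
have h := le_trans (mxfnorm_fst (u - u0)) Hu.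
apply: le_trans (ler_wpM2l K0 h) _.
by rewrite mulrA ler_pdivrMr// mulrC ler_wpM2l ?lerDl// ltW.
Qed.

(** Cauchy-Schwarz for the form of [Q] at [W] and [Q W] bounds [|Q W|^2]. For [W] in the range,
    [W = Q X'] with [|X'| <= 2 Kg |W|], so [|W|^2 = <X', Q W>] gives [|W| <= 2 Kg |Q W|]. *)
Lemma Q_coercive : exists2 K, 0 <= K & forall W, (Q @` @symS R n) W ->
  mxdot W W <= K * mxdot W (Q W) /\ mxdot (Q W) (Q W) <= K * mxdot W (Q W).
Proof.
have [KQ KQ0 HQ] := linear_bounded Q.
have [g gE] := range_section; have [Kg Kg0 Hg] := linear_bounded g.
have QW W : symS W -> mxdot (Q W) (Q W) <= KQ * mxdot W (Q W).
  move=> Ws; have := Q_CS Ws (Q_sym Ws); rewrite (Q_selfadj Ws (Q_sym Ws)).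
  have q0 := Q_psd Ws.
  have h : mxdot (Q W) (Q (Q W)) <= KQ * mxdot (Q W) (Q W).
    apply: le_trans (ler_norm _) _; apply: le_trans (mxdot_CS _ _) _.
    by rewrite -sqr_mxfnorm expr2 mulrCA ler_wpM2l ?mxfnorm_ge0.
  have [->|w0] := eqVneq (mxdot (Q W) (Q W)) 0; first by rewrite mulr_ge0.
  have wp : 0 < mxdot (Q W) (Q W) by rewrite lt0r w0 mxdot_ge0.
  move=> h2; have := le_trans h2 (ler_wpM2l q0 h).
  by rewrite expr2 mulrA ler_pM2r// mulrC.
exists (KQ + (2 * Kg) ^+ 2 * KQ); first by rewrite addr_ge0// mulr_ge0// sqr_ge0.
move=> W QSW; have Ws : symS W by case: QSW => X Xs <-; exact: Q_sym.
have q0 := Q_psd Ws; have QW1 := QW W Ws; split; last first.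
  by apply: le_trans QW1 _; rewrite ler_wpM2r// lerDl mulr_ge0// sqr_ge0.
pose X' := g W + (g W)^T.
have X's : symS X' by rewrite /symS /X' /= linearD /= trmxK addrC.
have QX' : Q X' = W by exact: gE.
have X'b : mxfnorm X' <= 2 * Kg * mxfnorm W.
  by apply: le_trans (mxfnormD _ _) _; rewrite mxfnorm_tr; have := Hg W; lra.
have h : mxdot W W <= 2 * Kg * mxfnorm W * mxfnorm (Q W).
  rewrite -{2}QX' (Q_selfadj Ws X's) mxdotC.
  exact: le_trans (ler_norm _) (mxdot_CS_le X'b (lexx _)).
apply: (@le_trans _ _ ((2 * Kg) ^+ 2 * mxdot (Q W) (Q W))); last first.
  have h3 := ler_wpM2l (sqr_ge0 (2 * Kg)) QW1.
  by apply: le_trans h3 _; rewrite [leRHS]mulrDl [leLHS]mulrA lerDr mulr_ge0.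
rewrite -!sqr_mxfnorm -exprMn in h *; rewrite ler_pXn2r// ?nnegrE ?mulr_ge0 ?mxfnorm_ge0//.
have [->|w0] := eqVneq (mxfnorm W) 0; first by rewrite !mulr_ge0 ?mxfnorm_ge0.
have wp : 0 < mxfnorm W by rewrite lt0r w0 mxfnorm_ge0.
by move: h; rewrite expr2 [2 * Kg * _]mulrC -mulrA ler_pM2l.
Qed.

Local Notation V_ := (V_reg Q A Aadj sigma).

Lemma V_regE P lam eps (d : E) : V_ P lam eps d =
  (Q d.1 - sigma *: Q (U_op P lam (T d)), sigma *: A (U_op P lam (T d)) + eps *: d.2).
Proof.
have -> : V_ P lam eps d = (Q d.1 + sigma *: Q (U_op P lam (Q d.1 - Aadj d.2)) + eps *: 0,
   - (sigma *: A (U_op P lam (Q d.1 - Aadj d.2))) + eps *: d.2) by [].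
rewrite -[Q d.1 - _]opprB -/(T d) U_opN scaler0 addr0 (linearN Q) (linearN A).
by rewrite scalerN scalerN opprK.
Qed.

Lemma pdot_V P lam eps (u v : E) : symS u.1 -> symS v.1 ->
  pdot u (V_ P lam eps v) =
  mxdot u.1 (Q v.1) + sigma * mxdot (T u) (U_op P lam (T v)) + eps * mxdot u.2 v.2.
Proof.
move=> us vs; have Us := U_op_sym P lam (T_sym vs).
rewrite V_regE; move: (U_op _ _ _) Us => G Gs.
rewrite /pdot /= mxdotBr mxdotDr !mxdotZr (Q_selfadj us Gs) [mxdot u.2 (A G)]mxdotC.
by rewrite Aadj_adj// /T mxdotBl (mxdotC G); ring.
Qed.

Lemma V_linear P lam eps a (u v : E) :
  V_ P lam eps (a *: u + v) = a *: V_ P lam eps u + V_ P lam eps v.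
Proof.
rewrite !V_regE T_linear U_opZD.
have -> : (a *: u + v).1 = a *: u.1 + v.1 by [].
have -> : (a *: u + v).2 = a *: u.2 + v.2 by [].
move: (U_op _ _ (T u)) (U_op _ _ (T v)) => G H.
have pairZD c (x y : 'M[R]_n) (z w : 'cV[R]_m) :
  c *: ((x, z) : E) + (y, w) = (c *: x + y, c *: z + w) by [].
rewrite pairZD (linearP Q a G H) (linearP A) (linearP Q).
by congr (_, _); apply/matrixP => i j; rewrite !mxE; ring.
Qed.

Lemma V_dom P lam eps (d : E) : L d -> L (V_ P lam eps d).
Proof.
move=> Ld; have ds := dom_sym Ld; rewrite V_regE; split => //=.
exists (d.1 - sigma *: U_op P lam (T d)); last by rewrite linearB linearZ.
by apply: symSB => //; apply: symSZ; apply: U_op_sym; exact: T_sym.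
Qed.

(** Definiteness at an arbitrary iterate, as CG requires: [eps] controls [d.2], and [Q_coercive]
    controls [d.1]. *)
Lemma V_pos P lam eps (d : E) : P^T *m P = 1%:M -> 0 < eps -> L d ->
  pdot d (V_ P lam eps d) <= 0 -> d = 0.
Proof.
move=> P1 e0 Ld; have ds := dom_sym Ld; rewrite pdot_V//.
have [K K0 HK] := Q_coercive; have [HK1 _] := HK d.1 (proj1 Ld).
have u0 := mulr_ge0 (ltW sigma_gt0) (mxdot_U_op_ge0 P lam (T d)).
have q0 := Q_psd ds; have y0 := mxdot_ge0 d.2; have ey0 := mulr_ge0 (ltW e0) y0.
move=> h; have q1 : mxdot d.1 (Q d.1) = 0 by lra.
have y1 : mxdot d.2 d.2 = 0.
  by apply/eqP; rewrite -(mulrI_eq0 _ (lregP (lt0r_neq0 e0))); apply/eqP; lra.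
apply: pnorm_eq0; apply/eqP; rewrite -sqrf_eq0 sqr_pnorm; apply/eqP.
rewrite /pdot y1 addr0; apply/eqP; rewrite eq_le mxdot_ge0 andbT.
by move: HK1; rewrite q1 mulr0.
Qed.

Lemma V_bounded : exists2 K, 0 <= K & forall P lam eps (d : E),
  P^T *m P = 1%:M -> 0 <= eps <= 1 -> pnorm (V_ P lam eps d) <= K * pnorm d.
Proof.
have [KT KT0 HT] := T_bounded; have [KQ KQ0 HQ] := linear_bounded Q.
have [KA KA0 HA] := linear_bounded A; have s0 := ltW sigma_gt0.
exists (KQ + sigma * (KQ * KT) + (sigma * (KA * KT) + 1)).
  by rewrite !addr_ge0 ?mulr_ge0.
move=> P lam eps d P1 /andP[e0 e1]; rewrite V_regE.
have GT : mxfnorm (U_op P lam (T d)) <= KT * pnorm d.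
  exact: le_trans (mxfnorm_U_op _ P1 _) (HT d).
move: (U_op _ _ _) GT => G GT.
apply: le_trans (pnorm_le_sum _) _ => /=; rewrite !mulrDl; apply: lerD.
  apply: le_trans (mxfnormB _ _) _; apply: lerD.
    by apply: le_trans (HQ _) _; rewrite ler_wpM2l ?mxfnorm_fst.
  rewrite mxfnormZ gtr0_norm// -mulrA ler_pM2l//; apply: le_trans (HQ _) _.
  by rewrite -mulrA ler_wpM2l.
apply: le_trans (mxfnormD _ _) _; apply: lerD.
  rewrite mxfnormZ gtr0_norm// -mulrA ler_pM2l//; apply: le_trans (HA _) _.
  by rewrite -mulrA ler_wpM2l.
by rewrite mxfnormZ ger0_norm//; apply: ler_pM; rewrite ?mxfnorm_ge0 ?mxfnorm_snd.
Qed.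

Lemma gradE_semismooth (z0 : E) : L z0 -> exists2 K, 0 <= K &
  forall (z h : E) P lam eps, z = z0 + h -> L h -> P^T *m P = 1%:M ->
    S_ z = P *m diag_mx lam *m P^T -> 0 <= eps ->
    pnorm (gradE z - gradE z0 - V_ P lam eps h) <= K * pnorm h ^+ 2 + eps * pnorm h.
Proof.
move=> Lz; have zs := dom_sym Lz.
have [KT KT0 HT] := T_bounded; have [KQ KQ0 HQ] := linear_bounded Q.
have [KA KA0 HA] := linear_bounded A; have s0 := ltW sigma_gt0.
have [K K0 HK] := psd_proj_semismooth (S_sym zs).
exists (sigma * (KQ * (K * KT ^+ 2)) + sigma * (KA * (K * KT ^+ 2))).
  by rewrite !addr_ge0 ?mulr_ge0// exprn_ge0.
move=> z h P lam eps zh Lh P1 SE e0.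
have := HK _ _ _ P1 SE; have := HT h.
rewrite V_regE /gradE.
have -> : Q z.1 = Q z0.1 + Q h.1 by rewrite zh linearD.
rewrite (S_add zh); move: (S_ z0) (T h) => X H HTh.
have -> : X + H - X = H by rewrite addrC addKr.
move: (X + H) => Y; move: (psd_proj X) (psd_proj Y) (U_op _ _ _) => PX PY G.
set F := PY - PX - G => HF.
have {HF} FT : mxfnorm F <= K * KT ^+ 2 * pnorm h ^+ 2.
  apply: le_trans HF _; rewrite -mulrA ler_wpM2l// -exprMn ler_pXn2r// ?nnegrE//.
    exact: mxfnorm_ge0.
  by rewrite mulr_ge0// pnorm_ge0.
rewrite !pairB.
rewrite [X in pnorm X](_ : _ = (- (sigma *: Q F), sigma *: A F - eps *: h.2)); last first.
  congr (_, _).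
    by rewrite /F !(linearB Q); apply/matrixP => i j; rewrite !mxE; ring.
  by rewrite /F !(linearB A); apply/matrixP => i j; rewrite !mxE; ring.
apply: le_trans (pnorm_le_sum _) _ => /=; rewrite mxfnormN mulrDl -addrA; apply: lerD.
  rewrite mxfnormZ gtr0_norm// -mulrA ler_pM2l//; apply: le_trans (HQ _) _.
  by rewrite -mulrA ler_wpM2l.
apply: le_trans (mxfnormB _ _) _; apply: lerD.
  rewrite mxfnormZ gtr0_norm// -mulrA ler_pM2l//; apply: le_trans (HA _) _.
  by rewrite -mulrA ler_wpM2l.
by rewrite mxfnormZ ger0_norm// ler_wpM2l// mxfnorm_snd.
Qed.

(** Write [y = A H] with [H] in the lineality space; then [|y|^2 = <H, A^* y>], which vanishes by
    [lineality_psd_orth]. *)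
Lemma nondegenerate_inj (z0 : E) : L z0 ->
  A @` lineality (tangent_cone (@psdS R n) (psd_proj (S_ z0))) = [set: 'cV[R]_m] ->
  forall y, psd_proj (S_ z0) *m Aadj y = 0 -> y = 0.
Proof.
move=> Lz; have [Zp _ _] := moreau (S_sym (dom_sym Lz)).
move: (psd_proj _) Zp => Z Zp AV y Zy.
have : [set: 'cV[R]_m] y by [].
rewrite -AV => -[H HV HE]; apply: mxdot_eq0; rewrite -{1}HE.
have Hs : symS H.
  case: HV => V VT HV; apply: (tangent_cone_psd_sym Zp); exact: VT.
by rewrite Aadj_adj//; exact: (lineality_psd_orth Zp (Aadj_sym y) Zy).
Qed.

(** With [H = Q d.1 - A^* d.2], injectivity gives [c1 |d.2| <= |Pi(X) A^* d.2| <= |Pi(X)| |Q d.1| +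
    |Pi(X) H|]. Replacing [Pi(X)] by the nearby [Pi(Y)] bounds the last term by the form of [U_Y],
    while [Q_coercive] handles [d.1] and [Q d.1]. *)
Lemma V_uniform_pd (z0 : E) : L z0 ->
  (forall y, psd_proj (S_ z0) *m Aadj y = 0 -> y = 0) ->
  exists c r, [/\ 0 < c, 0 < r & forall (z h : E) P lam eps, z = z0 + h -> L h ->
    pnorm h <= r -> P^T *m P = 1%:M -> S_ z = P *m diag_mx lam *m P^T -> 0 <= eps ->
    forall d, L d -> c * pnorm d ^+ 2 <= pdot d (V_ P lam eps d)].
Proof.
move=> Lz inj; have Ss := S_sym (dom_sym Lz).
have [KT KT0 HT] := T_bounded; have [KA KA0 HA] := linear_bounded Aadj.
have [C C0 HC] := Q_coercive.
pose f : {linear 'cV[R]_m -> 'M[R]_n} := (mulmx (psd_proj (S_ z0)) \o Aadj)%FUN.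
have [|c1 c10 Hc1] := linear_inj_bounded_below (f := f); first exact: inj.
have {}Hc1 y : c1 * mxfnorm y <= mxfnorm (psd_proj (S_ z0) *m Aadj y) by exact: Hc1.
move: (S_add (z := z0)) => Sadd.
move: (S_ z0) Ss Hc1 Sadd {f inj} => X Xs Hc1 Sadd.
pose M := mxfnorm (psd_proj X) + KT.
have M0 : 0 <= M by rewrite addr_ge0// mxfnorm_ge0.
pose B := mxfnorm X + KT; have B0 : 0 <= B by rewrite addr_ge0// mxfnorm_ge0.
(* Small enough for the cost [KT r KA |d.2|] of passing from [Pi(X)] to [Pi(Y)] to be absorbed by
   half of [c1 |d.2|]. *)
pose r := Num.min 1 (c1 / (2 * (KT * KA + 1))).
have kk : 0 < 2 * (KT * KA + 1) by rewrite mulr_gt0// ltr_wpDl// mulr_ge0.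
have r0 : 0 < r by rewrite lt_min ltr01 divr_gt0.
have r1 : r <= 1 by rewrite ge_min lexx.
have rK : KT * r * KA <= c1 / 2.
  have : r <= c1 / (2 * (KT * KA + 1)) by rewrite ge_min lexx orbT.
  rewrite ler_pdivlMr//; have := mulr_ge0 KT0 KA0; have := mulr_ge0 (ltW r0) (ltW r0).
  nra.
(* The first term bounds [|d.1|^2]; the others come from squaring
   [(c1 / 2) |d.2| <= M |Q d.1| + |Pi(Y) H|] and inserting [|Q d.1|^2 <= C q] and
   [|Pi(Y) H|^2 <= 2 B^2 u]. *)
pose Ktot := C + 8 * M ^+ 2 * C / c1 ^+ 2 + 16 * B ^+ 2 / (c1 ^+ 2 * sigma).
have Kt0 : 0 <= Ktot.
  by rewrite !addr_ge0 ?divr_ge0 ?mulr_ge0 ?sqr_ge0 ?exprn_ge0// ltW.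
have Kt1 : 0 < Ktot + 1 by rewrite ltr_wpDl.
exists (Ktot + 1)^-1, r; split => //; first by rewrite invr_gt0.
move=> z h P lam eps zh Lh hr P1 SE e0 d Ld.
have ds := dom_sym Ld; rewrite pdot_V// -[T d]opprB U_opN mxdotNl mxdotNr opprK.
set H := Q d.1 - Aadj d.2.
have HTr : mxfnorm (T h) <= KT * r by apply: le_trans (HT h) _; rewrite ler_wpM2l.
have := psd_proj_mul_bound P1 H SE.
move: SE; rewrite (Sadd _ _ zh) => SE; have Ths := T_sym (dom_sym Lh).
have := psd_proj_lip (symSD Xs Ths) Xs.
have -> : X + T h - X = T h by rewrite addrC addKr.
have YB : mxfnorm (X + T h) <= B.
  by apply: le_trans (mxfnormD _ _) _; rewrite lerD2l (le_trans HTr)// ler_piMr.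
move: (X + T h) YB => Y YB {SE} lipY UB.
have [HC1 HC2] := HC d.1 (proj1 Ld).
have u0 := mxdot_U_op_ge0 P lam H.
move: (mxdot H (U_op P lam H)) UB u0 => u UB u0.
have q0 := Q_psd ds.
set a := mxfnorm (Q d.1); set t := mxfnorm d.2.
have a0 : 0 <= a := mxfnorm_ge0 _; have t0 : 0 <= t := mxfnorm_ge0 _.
have HH : mxfnorm H <= a + KA * t.
  by apply: le_trans (mxfnormB _ _) _; rewrite lerD2l.
set w := mxfnorm (psd_proj Y *m H) in UB.
have w0 : 0 <= w := mxfnorm_ge0 _.
have key : c1 / 2 * t <= M * a + w.
  have h1 : c1 * t <= mxfnorm (psd_proj X) * a + mxfnorm (psd_proj X *m H).
    apply: le_trans (Hc1 _) _.
    have -> : Aadj d.2 = Q d.1 - H by rewrite /H opprB addrC subrK.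
    rewrite mulmxBr; apply: le_trans (mxfnormB _ _) _.
    by rewrite lerD2r mxfnormM.
  have h2 : mxfnorm (psd_proj X *m H) <= w + KT * r * (a + KA * t).
    have -> : psd_proj X *m H = psd_proj Y *m H - (psd_proj Y - psd_proj X) *m H.
      by rewrite mulmxBl opprB addrC subrK.
    apply: le_trans (mxfnormB _ _) _; rewrite lerD2l; apply: le_trans (mxfnormM _ _) _.
    by apply: ler_pM; rewrite ?mxfnorm_ge0// (le_trans lipY).
  have h3 : KT * r * a <= KT * a by rewrite ler_wpM2r// ler_piMr.
  have h4 : KT * r * (KA * t) <= c1 / 2 * t by rewrite mulrA ler_wpM2r.
  rewrite /M; lra.
rewrite sqr_pnorm /pdot.
have t2 : mxdot d.2 d.2 = t ^+ 2 by rewrite sqr_mxfnorm.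
have a2 : mxdot (Q d.1) (Q d.1) = a ^+ 2 by rewrite sqr_mxfnorm.
rewrite t2; rewrite a2 in HC2.
have Y2 : mxfnorm Y ^+ 2 <= B ^+ 2 by rewrite ler_pXn2r// nnegrE mxfnorm_ge0.
move: (mxdot d.1 d.1) (mxdot d.1 (Q d.1)) HC1 HC2 q0 => x q HC1 HC2 q0.
have et0 : 0 <= eps * t ^+ 2 by rewrite mulr_ge0// sqr_ge0.
have w2 : w ^+ 2 <= 2 * B ^+ 2 * u.
  by apply: le_trans UB _; rewrite ler_wpM2r// ler_wpM2l.
have key2 : (c1 / 2) ^+ 2 * t ^+ 2 <= 2 * M ^+ 2 * (C * q) + 2 * (2 * B ^+ 2 * u).
  apply: (@le_trans _ _ ((M * a + w) ^+ 2)).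
    by rewrite -exprMn ler_pXn2r// ?nnegrE ?addr_ge0 ?mulr_ge0 ?invr_ge0// ltW.
  have h1 : (M * a + w) ^+ 2 <= 2 * (M ^+ 2 * a ^+ 2) + 2 * w ^+ 2.
    by have := sqr_ge0 (M * a - w); lra.
  have h2 : M ^+ 2 * a ^+ 2 <= M ^+ 2 * (C * q) by rewrite ler_wpM2l// sqr_ge0.
  by lra.
have t2b : t ^+ 2 <= 8 * M ^+ 2 * C / c1 ^+ 2 * q + 16 * B ^+ 2 / (c1 ^+ 2 * sigma) * (sigma * u).
  have -> : 8 * M ^+ 2 * C / c1 ^+ 2 * q + 16 * B ^+ 2 / (c1 ^+ 2 * sigma) * (sigma * u) =
     (2 * M ^+ 2 * (C * q) + 2 * (2 * B ^+ 2 * u)) / ((c1 / 2) ^+ 2).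
    by field; rewrite !gt_eqF.
  by rewrite ler_pdivlMr ?exprn_gt0 ?divr_gt0// mulrC.
have su0 : 0 <= sigma * u by rewrite mulr_ge0// ltW.
rewrite mulrC ler_pdivrMr//.
have k1 : 0 <= 8 * M ^+ 2 * C / c1 ^+ 2.
  by rewrite ?divr_ge0 ?mulr_ge0 ?sqr_ge0 ?exprn_ge0// ltW.
have k2 : 0 <= 16 * B ^+ 2 / (c1 ^+ 2 * sigma).
  by rewrite ?divr_ge0 ?mulr_ge0 ?sqr_ge0 ?exprn_ge0// ltW.
rewrite /Ktot.
move: (8 * M ^+ 2 * C / c1 ^+ 2) (16 * B ^+ 2 / (c1 ^+ 2 * sigma)) k1 k2 t2b => k1 k2 k10 k20 t2b.
apply: (@le_trans _ _ (C * q + (k1 * q + k2 * (sigma * u)))); first exact: lerD.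
have := mulr_ge0 C0 et0; have := mulr_ge0 k10 et0; have := mulr_ge0 k20 et0.
have := mulr_ge0 C0 su0; have := mulr_ge0 k10 su0; have := mulr_ge0 k20 q0.
by lra.
Qed.

(** Where the gradient vanishes, [eps = 0] and [V] may be singular; hence the premise [gradE z <> 0]
    on the decrease of the CG model. *)
Lemma sncg_step_spec (mu etabar tau tau1 tau2 delta : R) (z z' : E) :
  0 < tau1 < 1 -> 0 < tau2 < 1 -> tau <> -1 -> L z ->
  sncg_step Q A Aadj b Chat sigma mu etabar tau tau1 tau2 delta z z' ->
  exists P lam eps d k, [/\ P^T *m P = 1%:M, S_ z = P *m diag_mx lam *m P^T,
    0 <= eps <= 1, eps <= pnorm (gradE z) &
    [/\ L d, pnorm (V_ P lam eps d + gradE z) <= Num.min etabar (pnorm (gradE z) `^ (1 + tau)),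
      pdot (gradE z) d <= 0,
      gradE z <> 0 -> pdot d (V_ P lam eps d) <= - (2 * pdot (gradE z) d) &
    [/\ phi_ (z + delta ^+ k *: d) <= phi_ z + mu * delta ^+ k * pdot (gradE z) d,
      forall l, (l < k)%N ->
        ~ (phi_ (z + delta ^+ l *: d) <= phi_ z + mu * delta ^+ l * pdot (gradE z) d) &
      z' = z + delta ^+ k *: d]]].
Proof.
move=> /andP[t1 t1'] /andP[t2 t2'] tau1n Lz; rewrite /sncg_step /armijo (grad_phiE Lz).
have Lg := gradE_dom Lz; move: (gradE z) Lg => g Lg.
move=> [P [lam [l [d [k [[P1 SE _] [dE [Ld [res [arm [first step]]]]]]]]]]].
have g0 := pnorm_ge0 g.
pose eps := tau1 * Num.min tau2 (pnorm g).
have mn0 : 0 <= Num.min tau2 (pnorm g) by rewrite le_min g0 ltW.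
have mn1 : Num.min tau2 (pnorm g) <= 1 by rewrite ge_min ltW.
have mn2 : Num.min tau2 (pnorm g) <= pnorm g by rewrite ge_min lexx orbT.
have desc : g <> 0 -> pdot d (V_ P lam eps d) <= - (2 * pdot g d).
  move=> gn0; have e0 : 0 < eps.
    rewrite mulr_gt0// lt_min t2 /= lt0r g0 andbT.
    by apply/eqP => /pnorm_eq0.
  have := @cg_descent R m n L (V_ P lam eps) (- g) dom0 domZD (V_linear P lam eps)
    (V_dom P lam eps) _ (fun u Lu => V_pos P1 e0 Lu) (domN Lg) l.
  rewrite -dE pdotNl mulrN; apply => u v Lu Lv.
  have us := dom_sym Lu; have vs := dom_sym Lv.
  rewrite !pdot_V// (Q_selfadj us vs) mxdotC (mxdot_U_opC P lam (T u)).
  by rewrite (mxdotC u.2).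
exists P, lam, eps, d, k; split => //.
- by rewrite mulr_ge0 ?(ltW t1)//= mulr_ile1 ?(ltW t1) ?(ltW t1').
- by apply: le_trans mn2; rewrite ler_piMl ?(ltW t1').
split => //.
have [->|gn0] := pselect (g = 0); first by rewrite pdotC pdot0r.
have := desc gn0; clear arm first step res; suff : 0 <= pdot d (V_ P lam eps d).
  by move: (pdot d _) (pdot g d) => x y; lra.
have ds := dom_sym Ld.
rewrite pdot_V//; apply: addr_ge0; last first.
  by apply: mulr_ge0 (mxdot_ge0 _); exact: mulr_ge0 (ltW t1) mn0.
by apply: addr_ge0 (Q_psd ds) _; exact: mulr_ge0 (ltW sigma_gt0) (mxdot_U_op_ge0 _ _ _).
Qed.

End Problem.

(** * SNCG as an instance of the abstract inexact Newton method *)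

Theorem theorem3p3 (R : realType) (m n : nat)
    (Q : {linear 'M[R]_n -> 'M[R]_n}) (A : {linear 'M[R]_n -> 'cV[R]_m})
    (Aadj : {linear 'cV[R]_m -> 'M[R]_n})
    (b : 'cV[R]_m) (C Xhat : 'M[R]_n)
    (sigma mu etabar tau tau1 tau2 delta : R)
    (Q_sym : forall X : 'M[R]_n, symS X -> symS (Q X))
    (Q_selfadj : forall X Y : 'M[R]_n, symS X -> symS Y ->
       mxdot X (Q Y) = mxdot (Q X) Y)
    (Q_psd : forall X : 'M[R]_n, symS X -> 0 <= mxdot X (Q X))
    (Aadj_sym : forall y : 'cV[R]_m, symS (Aadj y))
    (Aadj_adj : forall (X : 'M[R]_n) (y : 'cV[R]_m), symS X ->
       mxdot (A X) y = mxdot X (Aadj y))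
    (C_sym : symS C) (Xhat_sym : symS Xhat) (sigma_gt0 : 0 < sigma)
    (mu_bnd : 0 < mu < 2^-1) (etabar_bnd : 0 < etabar < 1)
    (tau_bnd : 0 < tau <= 1) (tau1_bnd : 0 < tau1 < 1)
    (tau2_bnd : 0 < tau2 < 1) (delta_bnd : 0 < delta < 1)
    (slater : exists2 X0 : 'M[R]_n, pdS X0 & A X0 = b)
    (A_onto : A @` @symS R n = [set: 'cV[R]_m])
    (W : nat -> 'M[R]_n) (y : nat -> 'cV[R]_m)
    (Wbar : 'M[R]_n) (ybar : 'cV[R]_m)
    (Wy_sncg : sncg_sequence Q A Aadj b (C - sigma^-1 *: Xhat) sigma
       mu etabar tau tau1 tau2 delta (fun j => (W j, y j)))
    (Wy_accum : cluster ((fun j => (W j, y j)) @ \oo) (Wbar, ybar))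
    (nondegenerate :
       A @` lineality (tangent_cone (@psdS R n)
         (psd_proj (Aadj ybar - Q Wbar - (C - sigma^-1 *: Xhat))))
       = [set: 'cV[R]_m]) :
  (fun j => (W j, y j)) @ \oo --> (Wbar, ybar) /\
  (fun j => pnorm ((W j.+1, y j.+1) - (Wbar, ybar)) : R^o) =O_\oo
    (fun j => pnorm ((W j, y j) - (Wbar, ybar)) `^ (1 + tau) : R^o).
Proof.
set Chat := C - sigma^-1 *: Xhat in Wy_sncg nondegenerate.
have C'_sym : symS Chat by apply: symSB => //; exact: symSZ.
set z := fun j => (W j, y j) in Wy_sncg Wy_accum.
have [tau0 tau1'] := andP tau_bnd.
have taun1 : tau <> -1 by move=> E; move: tau0; rewrite E; lra.
case: Wy_sncg => z0 zstep.
have Lz j : phi_dom Q (z j).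
  elim: j => // j IH.
  have [P [lam [eps [d [k [_ _ _ _ [Ld _ _ _ [_ _ ->]]]]]]]] :=
    sncg_step_spec Q_sym Q_selfadj Q_psd Aadj_sym Aadj_adj C'_sym sigma_gt0
      tau1_bnd tau2_bnd taun1 IH (zstep j).
  by apply: domD => //; exact: domZ.
have zacc e J : 0 < e -> exists2 j, (J <= j)%N & pnorm (z j - (Wbar, ybar)) <= e.
  move=> e0.
  (* Every tail of the sequence belongs to the image filter, so clustering yields arbitrarily late
     visits to each ball. *)
  have A1 : (z @ \oo) [set u | exists2 j, (J <= j)%N & u = z j].
    by exists J => // j /= Jj; exists j.
  have [_ [[j Jj ->] h]] := Wy_accum _ _ A1 (near_pnorm_le (Wbar, ybar) e0).
  by exists j.
have Lzbar : phi_dom Q (Wbar, ybar).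
  apply: dom_closed => e e0.
  by have [j _ h] := zacc e 0%N e0; exists (z j).
have inj := nondegenerate_inj Q_sym Aadj_sym Aadj_adj C'_sym Lzbar nondegenerate.
have [c [r [c0 r0 Vpd]]] :=
  V_uniform_pd Q_sym Q_selfadj Q_psd Aadj_sym Aadj_adj C'_sym sigma_gt0 Lzbar inj.
have [K1 K10 H1] := phi_upper b Q_sym Q_selfadj Q_psd Aadj_sym Aadj_adj C'_sym sigma_gt0.
have [K2 K20 H2] := gradE_lip A b Q_sym Aadj_sym C'_sym sigma_gt0.
have [K3 K30 H3] := phi_trapezoid b Q_sym Q_selfadj Aadj_sym Aadj_adj C'_sym sigma_gt0 Lzbar.
have [K4 K40 H4] := V_bounded Q A Aadj sigma_gt0.
have [K5 K50 H5] := gradE_semismooth A b Q_sym Aadj_sym C'_sym sigma_gt0 Lzbar.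
have step j := sncg_step_spec Q_sym Q_selfadj Q_psd Aadj_sym Aadj_adj C'_sym sigma_gt0
      tau1_bnd tau2_bnd taun1 (Lz j) (zstep j).
have {step} [P /choice[lam /choice[eps /choice[d /choice[k step]]]]] := choice step.
pose G := gradE Q A Aadj b Chat sigma.
pose V j := V_reg Q A Aadj sigma (P j) (lam j) (eps j).
have P1 j : (P j)^T *m P j = 1%:M by case: (step j).
have SE j : S_map Q Aadj Chat (z j) = P j *m diag_mx (lam j) *m (P j)^T by case: (step j).
have eps01 j : 0 <= eps j <= 1 by case: (step j).
have eps0 j : 0 <= eps j by have /andP[] := eps01 j.
have d_dom j : phi_dom Q (d j) by case: (step j) => _ _ _ _ [].
have d_res j : pnorm (V j (d j) + G (z j)) <= Num.min etabar (pnorm (G (z j)) `^ (1 + tau)).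
  by case: (step j) => _ _ _ _ [].
have d_desc0 j : pdot (G (z j)) (d j) <= 0 by case: (step j) => _ _ _ _ [].
have d_desc j : G (z j) <> 0 -> pdot (d j) (V j (d j)) <= - (2 * pdot (G (z j)) (d j)).
  by case: (step j) => _ _ _ _ [].
have V_semi j h : z j = (Wbar, ybar) + h -> phi_dom Q h ->
    pnorm (G (z j) - G (Wbar, ybar) - V j h) <= K5 * pnorm h ^+ 2 + pnorm (G (z j)) * pnorm h.
  move=> zh Lh; apply: le_trans (H5 _ _ _ _ _ zh Lh (P1 j) (SE j) (eps0 j)) _.
  by rewrite lerD2l ler_wpM2r ?pnorm_ge0//; case: (step j).
have V_pd j h : z j = (Wbar, ybar) + h -> phi_dom Q h -> pnorm h <= r ->
    forall u, phi_dom Q u -> c * pnorm u ^+ 2 <= pdot u (V j u).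
  by move=> zh Lh hr; exact: Vpd zh Lh hr (P1 j) (SE j) (eps0 j).
have [conv [K [J rate]]] := newton_converges (@domZD R m n Q)
  mu_bnd etabar_bnd tau_bnd delta_bnd (And5 K10 K20 K30 K40 K50) c0 r0
  H1 H2 H3 (fun j u => H4 _ _ _ u (P1 j) (eps01 j))
  (fun j => V_linear Q A Aadj sigma (P j) (lam j) (eps j)) V_semi V_pd Lz Lzbar d_dom d_res
  d_desc0 d_desc
  (fun j => let: And5 _ _ _ _ (And5 _ _ _ _ (And3 a _ _)) := step j in a)
  (fun j l => let: And5 _ _ _ _ (And5 _ _ _ _ (And3 _ a _)) := step j in a l)
  (fun j => let: And5 _ _ _ _ (And5 _ _ _ _ (And3 _ _ a)) := step j in a) zacc.
split.
  apply/cvgrPdist_le => e e0; have [J' HJ'] := conv e e0.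
  exists J' => // j /= /HJ' h; rewrite distrC; exact: le_trans (norm_le_pnorm _) h.
apply/eqO_exP; exists (`|K| + 1); first by rewrite ltr_wpDl.
exists J => // j /= /rate h.
rewrite [leLHS]ger0_norm ?pnorm_ge0// [X in _ * X]ger0_norm ?powR_ge0//.
apply: le_trans h _; rewrite ler_wpM2r ?powR_ge0//.
by apply: le_trans (ler_norm K) _; rewrite lerDl.
Qed.
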